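(* Let $L>0$ and consider testing $H_0:f\in\mathcal F_0$ against $H_1:f\in\mathcal F_1(\rho)$, where $\mathcal F_0=\{f\in\Sigma_L:Q[f]=0\}$, $\mathcal F_1(\rho)=\{f\in\Sigma_L:|Q[f]|\ge\rho^2\}$ and $$\Sigma_L=\Big\{f=\sum_{l\in\mathcal L}\theta_l[f]\varphi_l:\ \sum_{l\in\mathcal L}c_l\theta_l[f]^2\le1,\ \max\big(\|f\|_4,\|f\cdot\mathtt T_Q[f]\|_2\big)\le L\Big\}.$$ Assume that the sets $\mathcal L_+=\{l:q_l>0\}$ and $\mathcal L_-=\{l:q_l<0\}$ are both nonempty and that the $\xi_i$ are Gaussian. Then: 1. For every $\gamma<1/4$ there exists $C>0$ such that $\liminf_{n\to\infty}\gamma_n(\mathcal F_0,\mathcal F_1(Cn^{-1/4}))>\gamma$. 2. Let $\gamma\in(0,1)$ and let $T_n^0$ be a sequence of positive reals such that $4T_n^0\sqrt{M(T_n^0)}\ge n\,z_{1-\gamma/2}^{-1}$ for all large $n$. Assume: [D1] there exists $D_1>0$ such that $|\mathcal N(T_n^0)|\max_{l\in\mathcal N(T_n^0)}q_l^2\le D_1\sum_{l\in\mathcal N(T_n^0)}q_l^2$; [D5] $N^*(T_n^0)\to\infty$ and $N^*(T_n^0)\log N^*(T_n^0)=o(n)$; [D6] there exists $D_6>0$ such that $\sup_{\mathbf t\in\Delta}\sum_{l\in\mathcal N^*(T_n^0)}\varphi_l(\mathbf t)^2\le D_6N^*(T_n^0)$. Then there exists $C>0$ such that $\liminf_{n\to\infty}\gamma_n\big(\mathcal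 F_0,\mathcal F_1(C(T_n^0)^{-1/2})\big)\ge\gamma$.
   Context: Model: $\Delta=[0,1]^d$; one observes $(x_i,\mathbf t_i)$, $i=1,\dots,n$, with $x_i=f(\mathbf t_i)+\xi_i$, where the $\mathbf t_i$ are i.i.d. uniform on $\Delta$ and, conditionally on the design, the $\xi_i$ are i.i.d. with mean $0$ and variance $1$. $P_f$ denotes the law of the data; $\|\cdot\|_q$ is the $L_q(\Delta)$ norm. $\{\varphi_l\}_{l\in\mathcal L}$ ($\mathcal L$ countable) is an orthonormal basis of the functions in $L_2(\Delta)$ with zero integral; $\theta_l[f]=\int_\Delta f\varphi_l$; arrays $(c_l)$, $c_l\ge0$, and $(q_l)$, $q_l\in\mathbb R$, are given; $Q[f]=\sum_lq_l\theta_l[f]^2$. The minimax risk is $\gamma_n(\mathcal F_0,\mathcal F_1)=\inf_{\phi_n}\{\sup_{f\in\mathcal F_0}P_f(\phi_n=1)+\sup_{f\in\mathcal F_1}P_f(\phi_n=0)\}$ over all $\{0,1\}$-valued measurable functions $\phi_n$ of the data. For $T>0$: $\mathcal N(T)=\{l:q_l\ne0,\ c_l<T|q_l|\}$ (finite), $M(T)=\sum_{l\in\mathcal N(T)}q_l^2$; for $a\in\{+,-\}$, $M_a(T)=\sum_{l\in\mathcal L_a\cap\mathcal N(T)}q_l^2$; $\mathcal N^*(T)=\mathcal L_+\cap\mathcal N(T)$ if $M_+(T)>M_-(T)$ and $\mathcal N^*(T)=\mathcal L_-\cap\mathcal N(T)$ otherwise; $N^*(T)=|\mathcal N^*(T)|$.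 The operator $\mathtt T_Q[f]=\sum_{l\in\mathcal N(T)}q_l\theta_l[f]\varphi_l$ is taken with truncation level $T=T_n^0$ in part 2, and with an arbitrary given sequence $T=T_n>0$ in part 1. $z_\alpha$ is the $\alpha$-quantile of $\mathcal N(0,1)$.
   Formalization: Part 1 additionally assumes that some φ_l with q_l>0 and some φ_l with q_l<0 lie in L_4(Δ); for an arbitrary orthonormal basis the class Σ_L can reduce to {0}, so that the minimax risk is 0 and the claim fails. *)

(* Defs.v *)
From HB Require Import structures.
From mathcomp Require Import all_boot all_order all_algebra finmap.
From mathcomp Require Import all_classical all_reals all_analysis. 
From mathcomp Require Import measurable_realfun.

Set Implicit Arguments.
Unset Strict Implicit.
Unset Printing Implicit Defensive.

Import Order.TTheory GRing.Theory Num.Theory.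
Import numFieldNormedType.Exports.

Local Open Scope classical_set_scope.
Local Open Scope ring_scope.

Section iid.
Context (R : realType) (d : measure_display) (T : measurableType d).

Section cons_tuple.
Variable n : nat.

Definition cons_tuple (x : T * n.-tuple T) : n.+1.-tuple T :=
  [tuple of x.1 :: x.2].

Lemma measurable_cons_tuple : measurable_fun [set: T * n.-tuple T] cons_tuple.
Proof. exact: measurable_cons. Qed.

HB.instance Definition _ :=
  isMeasurableFun.Build _ _ _ _ cons_tuple measurable_cons_tuple.
End cons_tuple.

(* The library has the product sigma-algebra on tuples but no product measure:
   this is P^{\otimes n}, characterized by iid_probE below. *)
Fixpoint iid_prob (P : probability T R) (n : nat) : probability (n.-tuple T) R :=
  match n with
  | 0 => \d_([tuple] : 0.-tuple T)
  | n'.+1 => distribution (P \x iid_prob P n')%E (@cons_tuple n')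
  end.

Lemma iid_probE (P : probability T R) n (A : 'I_n -> set T) :
  (forall i, measurable (A i)) ->
  iid_prob P n [set x | forall i, A i (tnth x i)] = (\prod_(i < n) P (A i))%E.
Proof.
elim: n A => [|n IH] A mA.
  rewrite big_ord0 /= diracE mem_set//= => -[[]//].
rewrite big_ord_recl -(IH (fun i => A (lift ord0 i)))//= /pushforward.
rewrite -product_measure1E//=.
  congr (_ _); apply/seteqP; split => [[x s] /= H|[x s] /= [H0 H] i].
    split; first exact: (H ord0).
    by move=> i; have := H (lift ord0 i); rewrite tnthS.
  have [->//|] := eqVneq i ord0.
  by case: (unliftP ord0 i) => [j -> _|->]; rewrite ?eqxx// tnthS.
have -> : [set x : n.-tuple T | forall i, A (lift ord0 i) (tnth x i)] =
    \bigcap_(i in [set: 'I_n]) ((fun x => tnth x i) @^-1` A (lift ord0 i)).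
  by apply/seteqP; split => x /= H i; [move=> _|]; exact: H.
apply: fin_bigcap_measurable => // i _.
by rewrite -[X in measurable X]setTI; exact: measurable_tnth.
Qed.

End iid.

Section regression.
Context (R : realType) (d : nat).

Definition point := d.-tuple (measurableTypeR R).

Definition cube : set point := [set t | forall i, 0 <= (tnth t i : R) <= 1].

(* Lebesgue measure on [0,1]^d, viewed as a measure on R^d carried by the cube;
   functions on the cube are represented by measurable functions on R^d, whose
   values outside the cube play no role. [measurableTypeR R] is R with its Borel
   sigma-algebra, the type on which the library's distributions live. *)
Definition unif : probability point R := iid_prob (uniform_prob (@ltr01 R)) d.

Definition regfun := {mfun point >-> R}.

Section observation.
Variable f : regfun.

(* (t, xi) |-> (f(t) + xi, t) *)
Definition observe (w : point * measurableTypeR R) : R * point :=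
  (f w.1 + w.2, w.1).

Lemma measurable_observe :
  measurable_fun [set: point * measurableTypeR R] observe.
Proof.
apply: measurable_fun_pair => //=.
apply: measurable_funD; first exact: measurableT_comp.
exact: measurable_snd.
Qed.

HB.instance Definition _ :=
  isMeasurableFun.Build _ _ _ _ observe measurable_observe.
End observation.

Definition data (n : nat) := n.-tuple (R * point)%type.

(* Standard Gaussian noise, independent of the uniform design. *)
Definition data_law (n : nat) (f : regfun) : probability (data n) R :=
  iid_prob (distribution (unif \x normal_prob 0 1)%E (observe f)) n.

(* [inf] and [sup] are those of R, so the supremum over an empty class is 0. *)
Definition minimax_risk (n : nat) (F0 F1 : set regfun) : R :=
  inf [set sup [set fine (data_law n f [set y | phi y]) | f in F0] +
           sup [set fine (data_law n f [set y | ~~ phi y]) | f in F1]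
      | phi in [set: {mfun data n >-> bool}]].

(* alpha-quantile of N(0,1) *)
Definition gauss_quantile (alpha : R) : R :=
  inf [set x | (alpha%:E <= normal_prob 0 1 `]-oo, x])%E].

Definition LqNorm (q : R) (g : point -> R) : \bar R :=
  ('N[unif]_(q%:E) [EFin \o g])%E.

Definition L2_centered : set regfun :=
  [set f | (LqNorm 2 f < +oo)%E /\ \int[unif]_t f t = 0].

Section basis.
Context (I : countType) (phi : I -> regfun).

Definition coef (f : regfun) (l : I) : R := \int[unif]_t (f t * phi l t).

(* f = \sum_l theta_l[f] phi_l, as an unconditional sum in L_2 *)
Definition expands (f : regfun) : Prop :=
  forall e : R, 0 < e -> exists J0 : {fset I}, forall J : {fset I},
    (J0 `<=` J)%fset ->
    (LqNorm 2 (fun t => f t - \sum_(l <- J) coef f l * phi l t)%R < e%:E)%E.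

Definition orthonormal_basis : Prop :=
  [/\ forall l, L2_centered (phi l),
      forall l m, \int[unif]_t (phi l t * phi m t) = (l == m)%:R &
      forall f, L2_centered f -> expands f].

Context (c q : I -> R).

Definition Lpos : set I := [set l | 0 < q l].
Definition Lneg : set I := [set l | q l < 0].

Definition NT (T : R) : set I := [set l | q l != 0 /\ c l < T * `|q l|].

Definition card (A : set I) : nat := #|` fset_set A|.

Definition sumsq (A : set I) : R := \sum_(l \in A) q l ^+ 2.

Definition M (T : R) : R := sumsq (NT T).
Definition Mpos (T : R) : R := sumsq (Lpos `&` NT T).
Definition Mneg (T : R) : R := sumsq (Lneg `&` NT T).

Definition NTstar (T : R) : set I :=
  if Mneg T < Mpos T then Lpos `&` NT T else Lneg `&` NT T.

(* The series defining Q[f] is split into its positive and negative terms; both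
   parts are finite when \sum_l c_l theta_l[f]^2 <= 1, since |q_l| <= c_l / T
   outside the finite set NT T. *)
Definition Q (f : regfun) : R :=
  fine (\esum_(l in Lpos) (q l * coef f l ^+ 2)%:E) -
  fine (\esum_(l in Lneg) (- q l * coef f l ^+ 2)%:E).

Definition TQ (T : R) (f : regfun) (t : point) : R :=
  \sum_(l \in NT T) q l * coef f l * phi l t.

Definition Sigma (L T : R) : set regfun :=
  [set f | [/\ L2_centered f, expands f,
    (\esum_(l in [set: I]) (c l * coef f l ^+ 2)%:E <= 1)%E &
    (maxe (LqNorm 4 f) (LqNorm 2 (fun t => f t * TQ T f t)%R) <= L%:E)%E]].

Definition F0 (L T : R) : set regfun := [set f | Sigma L T f /\ Q f = 0].

Definition F1 (L T rho : R) : set regfun :=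
  [set f | Sigma L T f /\ rho ^+ 2 <= `|Q f|].

Definition D1 (T : nat -> R) : Prop := exists D : R, 0 < D /\
  forall n, (0 < n)%N ->
    (card (NT (T n)))%:R * \big[Num.max/0]_(l <- fset_set (NT (T n))) q l ^+ 2
      <= D * M (T n).

Definition D5 (T : nat -> R) : Prop :=
  let N n := card (NTstar (T n)) in
  ((fun n => (N n)%:R : R) @ \oo --> +oo) /\
  (fun n => (N n)%:R * ln (N n)%:R : R) =o_\oo (fun n => n%:R : R).

Definition D6 (T : nat -> R) : Prop := exists D : R, 0 < D /\
  forall n, (0 < n)%N -> forall t, cube t ->
    \sum_(l \in NTstar (T n)) phi l t ^+ 2 <= D * (card (NTstar (T n)))%:R.

End basis.
End regression.

(* Main.v *)
(* Both lower bounds compare the data law P_0 under one null function f0 with the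
   average of the laws P_s under alternatives f0 + h_s. Given the design, the
   second moment of the averaged likelihood ratio is the average over (s, s') of
   exp(sum_i h_s(t_i) h_s'(t_i)); it is bounded only on a good set of designs,
   whose complement is handled by Markov's inequality, so that no exponential
   moment of the h_s under the uniform law is ever needed.

   Part 1: f0 is a combination of one phi_l with q_l > 0 and one with q_l < 0
   such that Q f0 = 0, and f1 moves the first coefficient by a multiple of
   n^(-1/2); Q is not stationary at f0, so Q f1 is of order n^(-1/2).

   Part 2: f0 = 0 and h_s = a sum_l s_l phi_l, with random signs s_l, l in
   N*(T_n), where a^2 = kappa / (T_n sum_l |q_l|). The matrix
   (a^2 sum_i phi_k(t_i) phi_l(t_i))_(k, l) has squared Frobenius norm V of mean
   O(kappa^2), and the second moment is at most exp(4 V) when V <= 1/32: the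
   Frobenius norm replaces the operator norm, and no matrix concentration is
   needed. A fourth moment computation shows that h_s satisfies the norm
   constraints of Sigma_L for most s. *)

From HB Require Import structures.
Require Import Defs.
From mathcomp Require Import all_boot all_order all_algebra finmap.
From mathcomp Require Import all_classical all_reals all_analysis.
From mathcomp Require Import ring lra measurable_realfun.
Set Implicit Arguments.
Unset Strict Implicit.
Unset Printing Implicit Defensive.

Import Order.TTheory GRing.Theory Num.Theory.
Import numFieldNormedType.Exports.
Local Open Scope classical_set_scope.
Local Open Scope ring_scope.

(** In Part 2 the prior is adapted to [Q]. On N*(T_n) all q_l have one sign, so |Q h_s| = a^2 sum_l
    |q_l| for every choice of signs, and each draw is separated from the null; keeping the sign
    class with the larger share of M costs a factor 2. The choice of a^2 makes this value equal to
    kappa / T_n, while c_l < T_n |q_l| on N(T_n) gives sum_l c_l a^2 <= kappa. The link with n is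
    [D1]: up to a constant, the sum of |q_l| over N* is as large as |N(T_n)| max |q_l|, which turns
    the lower bound on T_n sqrt(M(T_n)) into n^2 a^4 N* = O(kappa^2). Three losses are subtracted
    from 1: the square root of the conditional chi-square divergence, the probability of bad
    designs, and the proportion of draws outside Sigma_L. Each is made at most (1 - gamma) / 3, by
    the threshold on V for the first and by kappa for the other two. *)

Lemma sumr_const_seq (R : pzSemiRingType) (J : Type) (s : seq J) (x : R) :
  \sum_(i <- s) x = (size s)%:R * x.
Proof. by rewrite big_const_seq count_predT iter_addr_0 mulr_natl. Qed.

(** * Gaussian shifts and integrals against i.i.d. laws *)

Section density.
Local Open Scope ereal_scope.
Context {d} {T : measurableType d} {R : realType}.
Context (mu nu : {measure set T -> \bar R}) (p : T -> R).
Hypotheses (mp : measurable_fun [set: T] p) (p0 : forall x, (0 <= p x)%R).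
Hypothesis nuE : forall A, measurable A -> nu A = \int[mu]_(x in A) (p x)%:E.

Import HBNNSimple.

Let density_nnsfun (f : {nnsfun T >-> R}) :
  \int[nu]_x (f x)%:E = \int[mu]_x ((f x)%:E * (p x)%:E).
Proof.
under [LHS]eq_integral do rewrite fimfunE -fsumEFin//.
rewrite ge0_integral_fsum//; last 2 first.
  - by move=> r; exact/measurable_EFinP/measurableT_comp.
  - by move=> n x _; rewrite EFinM nnfun_muleindic_ge0.
under [RHS]eq_integral.
  move=> x _; rewrite fimfunE -fsumEFin// muleC ge0_mule_fsumr; last first.
    by move=> r; rewrite EFinM nnfun_muleindic_ge0.
  over.
rewrite [RHS]ge0_integral_fsum//; last 2 first.
  - by move=> r; apply: emeasurable_funM; exact/measurable_EFinP/measurableT_comp.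
  - move=> r x _; apply: mule_ge0; first by rewrite lee_fin.
    by rewrite EFinM nnfun_muleindic_ge0.
apply: eq_fsbigr => r _.
rewrite integralZl_indic_nnsfun// integral_indic// setIT nuE//.
(* The sum runs over all reals [r]; negative ones are not values of [f], and their preimage is
   empty. *)
have [r0|r0] := ltP r 0%R.
  rewrite preimage_nnfun0// integral_set0 mule0 integral0_eq// => x _.
  by rewrite indicE in_set0 mulr0 mule0.
rewrite -ge0_integralZl//; last 2 first.
  - exact/measurable_EFinP/measurable_funTS.
  - by move=> x _; rewrite lee_fin.
rewrite integral_mkcond; apply: eq_integral => x _; rewrite patchE indicE.
by case: ifPn => _; rewrite /= ?mulr1 ?mulr0 ?mule0// muleC.
Qed.

Lemma ge0_integral_density (f : T -> \bar R) :
  measurable_fun [set: T] f -> (forall x, 0 <= f x) ->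
  \int[nu]_x f x = \int[mu]_x (f x * (p x)%:E).
Proof.
move=> mf f0; pose f_ := nnsfun_approx measurableT mf.
transitivity (lim ((\int[nu]_x (f_ n x)%:E) @[n --> \oo])).
  rewrite -monotone_convergence//=.
  - apply: eq_integral => ? _; apply/esym/cvg_lim => //=.
    exact: cvg_nnsfun_approx.
  - by move=> n; exact/measurable_EFinP/measurable_funTS.
  - by move=> n ? _; rewrite lee_fin.
  - by move=> ? _ ? ? mn; rewrite lee_fin; exact/lefP/nd_nnsfun_approx.
under eq_fun do rewrite density_nnsfun.
rewrite -monotone_convergence//=.
- apply: eq_integral => x _; apply/cvg_lim => //=.
  by apply: cvgeZr => //; exact: cvg_nnsfun_approx.
- by move=> n; apply: emeasurable_funM; exact/measurable_EFinP/measurable_funTS.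
- by move=> n x _; rewrite mule_ge0 ?lee_fin.
- move=> x _ m n mn; rewrite lee_pmul ?lee_fin//.
  exact/lefP/nd_nnsfun_approx.
Qed.

End density.

Section gauss_shift.
Context {R : realType}.
Local Open Scope ereal_scope.
Notation mu := (@lebesgue_measure R).
Implicit Type f : measurableTypeR R -> \bar R.

(** The image of Lebesgue measure under the shift agrees with it on half-open intervals, and these
    determine it. *)
Lemma ge0_integral_lebesgue_shift (c : R) f :
  measurable_fun [set: measurableTypeR R] f -> (forall x, 0 <= f x) ->
  \int[mu]_x f (x + c)%R = \int[mu]_x f x.
Proof.
move=> mf f0.
have mshift : measurable_fun [set: measurableTypeR R]
    ((fun x => (x + c)%R) : measurableTypeR R -> measurableTypeR R).
  exact: measurable_funD.
transitivity (\int[pushforward mu ((fun x => (x + c)%R) :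
    measurableTypeR R -> measurableTypeR R)]_x f x).
  by rewrite ge0_integral_pushforward.
apply: eq_measure_integral => /= A mA _; apply/esym.
apply: (@lebesgue_measure_unique R (pushforward mu _)) => //=.
move=> _ [[a b] _ <-] /=; rewrite /pushforward.
have -> : (fun x => (x + c)%R) @^-1` `]a, b]%classic =
    `](a - c)%R, (b - c)%R]%classic :> set R.
  by apply/seteqP; split => x /=; rewrite !in_itv/= ltrBlDr lerBrDr.
rewrite !lebesgue_measure_itv/= !lte_fin ltrD2r.
by case: ifP => // _; rewrite -!EFinD; congr (_%:E); ring.
Qed.

Lemma ge0_integral_normal_prob f :
  measurable_fun [set: measurableTypeR R] f -> (forall x, 0 <= f x) ->
  \int[normal_prob 0 1]_x f x = \int[mu]_x (f x * (normal_pdf 0 1 x)%:E).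
Proof.
move=> mf f0; apply: ge0_integral_density => //.
- exact: measurable_normal_pdf.
- by move=> x; exact: normal_pdf_ge0.
Qed.

(** After the substitution [y = c + x], the ratio of the Gaussian densities at [y - c] and [y] is
    [expR (c * y - c ^+ 2 / 2)]. *)
Lemma normal_prob_shift (c : R) f :
  measurable_fun [set: measurableTypeR R] f -> (forall x, 0 <= f x) ->
  \int[normal_prob 0 1]_x f (c + x)%R =
  \int[normal_prob 0 1]_x (f x * (expR (c * x - c ^+ 2 / 2))%:E).
Proof.
move=> mf f0.
have mexp : measurable_fun [set: measurableTypeR R]
    (fun x : measurableTypeR R => (expR (c * x - c ^+ 2 / 2))%:E).
  apply/measurable_EFinP; apply: measurableT_comp => //.
  by apply: measurable_funB => //; apply: measurable_funM.
rewrite !ge0_integral_normal_prob//; last 3 first.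
- exact: emeasurable_funM.
- by move=> x; rewrite mule_ge0// lee_fin expR_ge0.
- apply: measurableT_comp => //; exact: measurable_funD.
rewrite -[RHS](ge0_integral_lebesgue_shift c); last 2 first.
- apply: emeasurable_funM; first exact: emeasurable_funM.
  by apply/measurable_EFinP; exact: measurable_normal_pdf.
- move=> x; rewrite !mule_ge0//.
  by rewrite lee_fin normal_pdf_ge0.
apply: eq_integral => x _; rewrite addrC -muleA; congr (_ * _).
rewrite -EFinM !normal_pdfE ?oner_neq0//; congr (_%:E).
rewrite mulrCA; congr (_ * _)%R; rewrite /normal_fun -expRD; congr expR.
by rewrite !subr0 expr1n; field.
Qed.

End gauss_shift.

Section integral_EFin.
Local Open Scope ereal_scope.
Context {d} {T : measurableType d} {R : realType} (mu : {measure set T -> \bar R}).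
Implicit Types f g : T -> R.

Lemma ge0_integral_EFinD f g :
  measurable_fun [set: T] f -> measurable_fun [set: T] g ->
  (forall x, (0 <= f x)%R) -> (forall x, (0 <= g x)%R) ->
  \int[mu]_x (f x + g x)%:E = \int[mu]_x (f x)%:E + \int[mu]_x (g x)%:E.
Proof.
move=> mf mg f0 g0; under eq_integral do rewrite EFinD.
by rewrite ge0_integralD//; [move=> x _; rewrite lee_fin|exact/measurable_EFinP|
  move=> x _; rewrite lee_fin|exact/measurable_EFinP].
Qed.

Lemma ge0_integral_EFinZl (c : R) f :
  measurable_fun [set: T] f -> (forall x, (0 <= f x)%R) -> (0 <= c)%R ->
  \int[mu]_x (c * f x)%:E = c%:E * \int[mu]_x (f x)%:E.
Proof.
move=> mf f0 c0; under eq_integral do rewrite EFinM.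
by rewrite ge0_integralZl//; [exact/measurable_EFinP|move=> x _; rewrite lee_fin].
Qed.

Lemma ge0_integral_EFin_sum (I : Type) (s : seq I) (f : I -> T -> R) :
  (forall i, measurable_fun [set: T] (f i)) -> (forall i x, (0 <= f i x)%R) ->
  \int[mu]_x (\sum_(i <- s) f i x)%:E = \sum_(i <- s) \int[mu]_x (f i x)%:E.
Proof.
move=> mf f0; under eq_integral do rewrite -sumEFin.
by rewrite ge0_integral_sum//; [move=> i; exact/measurable_EFinP|
  move=> i x _; rewrite lee_fin].
Qed.

Lemma ge0_le_integral_EFin f g :
  measurable_fun [set: T] f -> measurable_fun [set: T] g ->
  (forall x, (0 <= f x)%R) -> (forall x, (f x <= g x)%R) ->
  \int[mu]_x (f x)%:E <= \int[mu]_x (g x)%:E.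
Proof.
move=> mf mg f0 fg; apply: ge0_le_integral => //.
- by move=> x _; rewrite lee_fin.
- exact/measurable_EFinP.
- exact/measurable_EFinP.
- by move=> x _; rewrite lee_fin.
Qed.

End integral_EFin.

Section iid_integral.
Local Open Scope ereal_scope.
Context {R : realType}.

Lemma iid_integralS d {T : measurableType d} (P : probability T R) n (F : n.+1.-tuple T -> \bar R) :
  measurable_fun [set: n.+1.-tuple T] F -> (forall w, 0 <= F w) ->
  \int[iid_prob P n.+1]_w F w =
  \int[P]_x \int[iid_prob P n]_w F (Defs.cons_tuple (x, w)).
Proof.
move=> mF F0; rewrite /= ge0_integral_distribution//.
rewrite (fubini_tonelli1 (F \o @Defs.cons_tuple _ T n))//.
- by apply: measurableT_comp => //; exact: Defs.measurable_cons_tuple.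
- by move=> x /=.
Qed.

Context {d1 d2 : measure_display}.
Context {T : measurableType d1} {U : measurableType d2}.

Lemma measurable_map_tuple n (g : T -> U) : measurable_fun [set: T] g ->
  measurable_fun [set: n.-tuple T] (fun w => map_tuple g w).
Proof.
move=> mg; apply/measurable_fun_tnthP => i.
rewrite (_ : _ \o _ = fun w => g (tnth w i)).
  by apply: measurableT_comp => //; exact: measurable_tnth.
by apply/funext => w /=; rewrite tnth_map.
Qed.

(* [g := id] gives an n-fold change of density, [l := 1] an n-fold marginal. *)
Lemma iid_integral_change (P1 : probability U R) (P0 : probability T R)
    (g : T -> U) (l : T -> R) :
  measurable_fun [set: T] g -> measurable_fun [set: T] l ->
  (forall x, (0 <= l x)%R) ->
  (forall F : U -> \bar R, measurable_fun [set: U] F -> (forall y, 0 <= F y) ->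
    \int[P1]_y F y = \int[P0]_x (F (g x) * (l x)%:E)) ->
  forall n (F : n.-tuple U -> \bar R),
  measurable_fun [set: n.-tuple U] F -> (forall y, 0 <= F y) ->
  \int[iid_prob P1 n]_y F y =
  \int[iid_prob P0 n]_w (F (map_tuple g w) * (\prod_(i < n) l (tnth w i))%:E).
Proof.
move=> mg ml l0 H.
have mprod m : measurable_fun [set: m.-tuple T]
    (fun w => (\prod_(i < m) l (tnth w i))%R).
  apply: measurable_prod => i _.
  by apply: measurableT_comp => //; exact: measurable_tnth.
elim=> [|n IH] F mF F0.
  rewrite /= !integral_dirac//; last first.
    apply: emeasurable_funM; last by apply/measurable_EFinP; exact: mprod.
    by apply: measurableT_comp => //; exact: measurable_map_tuple.
  rewrite !diracT !mul1e big_ord0 mule1; congr F; exact/esym/tuple0.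
have mFc : measurable_fun setT (F \o @Defs.cons_tuple _ U n).
  by apply: measurableT_comp => //; exact: Defs.measurable_cons_tuple.
rewrite iid_integralS// iid_integralS; last 2 first.
- apply: emeasurable_funM; last by apply/measurable_EFinP; exact: mprod.
  by apply: measurableT_comp => //; exact: measurable_map_tuple.
- by move=> w; rewrite mule_ge0// lee_fin prodr_ge0.
rewrite (H (fun x => \int[iid_prob P1 n]_w F (Defs.cons_tuple (x, w)))); last 2 first.
- apply: (@measurable_fun_fubini_tonelli_F _ _ _ _ _ (iid_prob P1 n)
    (F \o @Defs.cons_tuple _ U n)) => //.
  by move=> x; rewrite /=.
- by move=> x; exact: integral_ge0.
apply: eq_integral => x _.
rewrite IH//; last first.
  exact: (measurableT_comp mFc (measurable_pair1 (g x))).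
rewrite -ge0_integralZr//; last 3 first.
- apply: emeasurable_funM; last by apply/measurable_EFinP; exact: mprod.
  apply: (measurableT_comp (measurableT_comp mFc (measurable_pair1 (g x)))).
  exact: measurable_map_tuple.
- by move=> w _; rewrite mule_ge0// lee_fin prodr_ge0.
- by rewrite lee_fin.
apply: eq_integral => w _; rewrite -muleA -EFinM; congr (F _ * _%:E).
  by apply/val_inj.
rewrite big_ord_recl mulrC; congr (_ * _)%R.
by apply: eq_bigr => i _; rewrite tnthS.
Qed.

End iid_integral.

(** * Likelihood ratios and the testing bound *)

Section likelihood_ratio.
Local Open Scope ereal_scope.
Context {R : realType} {d : nat}.
Implicit Types f g h : regfun R d.

Definition obs_law f := distribution (@unif R d \x normal_prob 0 1) (observe f).

Lemma obs_integral f (F : R * Defs.point R d -> \bar R) :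
  measurable_fun [set: R * Defs.point R d] F -> (forall y, 0 <= F y) ->
  \int[obs_law f]_y F y =
  \int[@unif R d]_t \int[normal_prob 0 1]_z F ((f t + z)%R, t).
Proof.
move=> mF F0; rewrite ge0_integral_distribution//.
rewrite (fubini_tonelli1 (F \o observe f))//.
- by apply: measurableT_comp => //; exact: measurable_observe.
- by move=> x /=.
Qed.

(* Logarithm of the density, at the observation [(x, t)], of the law under [f + h]
   with respect to the law under [f]. *)
Definition llr f h (y : R * Defs.point R d) : R :=
  (h y.2 * (y.1 - f y.2) - h y.2 ^+ 2 / 2)%R.

Lemma measurable_llr f h : measurable_fun [set: R * Defs.point R d] (llr f h).
Proof.
have mh : measurable_fun [set: R * Defs.point R d] (fun y => h y.2).
  exact: measurableT_comp.
apply: measurable_funB.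
  apply: measurable_funM => //; apply: measurable_funB => //.
  exact: measurableT_comp.
by apply: measurable_funM => //; exact: measurable_funX.
Qed.

(** Given the design point [t], passing from [f] to [g] shifts the Gaussian noise by [h t];
    [normal_prob_shift] applies for each [t]. *)
Lemma obs_shift f g h : (forall t, g t = f t + h t)%R ->
  forall F : R * Defs.point R d -> \bar R,
  measurable_fun [set: R * Defs.point R d] F -> (forall y, 0 <= F y) ->
  \int[obs_law g]_y F y = \int[obs_law f]_y (F y * (expR (llr f h y))%:E).
Proof.
move=> gE F mF F0.
have mF2 : measurable_fun [set: R * Defs.point R d]
    (fun y => F y * (expR (llr f h y))%:E).
  apply: emeasurable_funM => //; apply/measurable_EFinP.
  by apply: measurableT_comp => //; exact: measurable_llr.
have F20 y : 0 <= F y * (expR (llr f h y))%:E.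
  by rewrite mule_ge0// lee_fin expR_ge0.
apply: (etrans (obs_integral g mF F0)).
apply: etrans (esym (obs_integral f mF2 F20)).
apply: eq_integral => t _.
have mFt : measurable_fun [set: measurableTypeR R] (fun z => F ((f t + z)%R, t)).
  apply: measurableT_comp => //; apply: measurable_fun_pair => //.
  exact: measurable_funD.
under eq_integral do rewrite gE -addrA.
rewrite (normal_prob_shift (h t) mFt (fun z => F0 _)).
by apply: eq_integral => z _; rewrite /llr/=; congr (_ * (expR _)%:E); ring.
Qed.

Lemma obs_design f (F : Defs.point R d -> \bar R) :
  measurable_fun [set: Defs.point R d] F -> (forall t, 0 <= F t) ->
  \int[obs_law f]_y F y.2 = \int[@unif R d]_t F t.
Proof.
move=> mF F0; rewrite obs_integral//; last exact: measurableT_comp.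
apply: eq_integral => t _ /=.
by rewrite integral_cst//= probability_setT mule1.
Qed.

Definition lr n f h (y : data R d n) : R :=
  (\prod_(i < n) expR (llr f h (tnth y i)))%R.

Definition design n (y : data R d n) : n.-tuple (Defs.point R d) := map_tuple snd y.

Lemma measurable_design n : measurable_fun [set: data R d n] (@design n).
Proof. exact: measurable_map_tuple. Qed.

Lemma measurable_lr n f h : measurable_fun [set: data R d n] (@lr n f h).
Proof.
apply: measurable_prod => i _; apply: measurableT_comp => //.
by apply: measurableT_comp; [exact: measurable_llr|exact: measurable_tnth].
Qed.

Lemma lr_ge0 n f h (y : data R d n) : (0 <= lr f h y)%R.
Proof. by apply: prodr_ge0 => i _; exact: expR_ge0. Qed.

Lemma data_integral_lr n f g h : (forall t, g t = f t + h t)%R ->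
  forall F : data R d n -> \bar R,
  measurable_fun [set: data R d n] F -> (forall y, 0 <= F y) ->
  \int[data_law n g]_y F y = \int[data_law n f]_y (F y * (lr f h y)%:E).
Proof.
move=> gE F mF F0.
have ml : measurable_fun [set: R * Defs.point R d] (fun y => expR (llr f h y)).
  by apply: measurableT_comp => //; exact: measurable_llr.
have l0 y : (0 <= expR (llr f h y))%R by exact: expR_ge0.
have mid : measurable_fun [set: R * Defs.point R d] id by exact: measurable_id.
apply: (etrans (iid_integral_change (P1 := obs_law g) (P0 := obs_law f)
  mid ml l0 (obs_shift gE) mF F0)).
apply: eq_integral => y _; congr (F _ * _).
by apply/val_inj => /=; rewrite map_id.
Qed.

Lemma data_integral_design n f (F : n.-tuple (Defs.point R d) -> \bar R) :
  measurable_fun [set: n.-tuple (Defs.point R d)] F -> (forall t, 0 <= F t) ->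
  \int[data_law n f]_y F (design y) = \int[iid_prob (@unif R d) n]_t F t.
Proof.
move=> mF F0.
have H (G : Defs.point R d -> \bar R) : measurable_fun [set: Defs.point R d] G ->
    (forall t, 0 <= G t) ->
    \int[@unif R d]_t G t = \int[obs_law f]_y (G y.2 * (cst 1%R y)%:E).
  move=> mG G0; rewrite -(obs_design f mG G0).
  by apply: eq_integral => y _; rewrite mule1.
apply/esym; apply: (etrans (iid_integral_change (P1 := @unif R d)
  (P0 := obs_law f) (measurable_snd) (measurable_cst _) (fun=> ler01) H mF F0)).
by apply: eq_integral => y _; rewrite big1// mule1.
Qed.

(* The exponential factor depends on the design only, and the other one is again a
   likelihood ratio, so it integrates to the law of the design. *)
Lemma lr_mul n f h1 h2 h (y : data R d n) : (forall t, h t = h1 t + h2 t)%R ->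
  (lr f h1 y * lr f h2 y = lr f h y *
   expR (\sum_(i < n) h1 (tnth (design y) i) * h2 (tnth (design y) i)))%R.
Proof.
move=> hE; rewrite expR_sum /lr -!big_split/=; apply: eq_bigr => i _.
rewrite -!expRD tnth_map /llr hE; congr expR; by field.
Qed.

End likelihood_ratio.

(** * Power of tests against a mixture, truncated to good designs *)

Section test_bound.
Context {R : realType} {d : nat} {J : Type}.
Variables (n : nat) (f0 : regfun R d) (S : seq J) (h f : J -> regfun R d).
Variables (V : n.-tuple (Defs.point R d) -> R) (K v b : R).
Hypotheses (S0 : (0 < size S)%N) (fE : forall s t, f s t = f0 t + h s t).
Hypotheses (mV : measurable_fun [set: n.-tuple (Defs.point R d)] V).
Hypotheses (V0 : forall t, 0 <= V t) (K0 : 0 < K) (b0 : 0 < b).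
Hypothesis intV : (\int[iid_prob (@unif R d) n]_t (V t)%:E <= v%:E)%E.
Hypothesis chi2 : forall t : n.-tuple (Defs.point R d), V t <= K ->
  \sum_(s <- S) \sum_(s' <- S)
    expR (\sum_(i < n) h s (tnth t i) * h s' (tnth t i))
  <= (1 + b) * (size S)%:R ^+ 2.

Let G := [set t | V t <= K].
Let U := iid_prob (@unif R d) n.
Let gam := fine (U G).

Let mG : measurable G.
Proof.
rewrite (_ : G = V @^-1` `]-oo, K]%classic); last first.
  by apply/seteqP; split => t /=; rewrite in_itv.
by rewrite -[X in measurable X]setTI; exact: mV.
Qed.

Let md : measurable_fun [set: data R d n] (@design R d n).
Proof. exact: measurable_design. Qed.

Let mDG : measurable (@design R d n @^-1` G).
Proof. by rewrite -[X in measurable X]setTI; exact: md. Qed.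

(** The design has the same law under every regression function, so the good event has one
    probability [gam] under the null and all alternatives. *)
Let pDG (g : regfun R d) : data_law n g (@design R d n @^-1` G) = gam%:E.
Proof.
rewrite -[X in data_law n g X]setIT -integral_indic//.
rewrite (@data_integral_design _ _ _ g (fun t => (\1_G t)%:E)).
- by rewrite integral_indic// setIT /gam fineK// fin_num_measure.
- exact/measurable_EFinP/measurable_indic.
- by move=> t; rewrite lee_fin.
Qed.

Let gam1 : 0 <= gam <= 1.
Proof.
rewrite fine_ge0//= -lee_fin fineK ?fin_num_measure//.
exact: probability_le1.
Qed.

(** By [lr_mul] the product of the two ratios is the ratio for the shift [h s + h s'] times a
    function of the design. The former is absorbed by changing the regression function to
    [f0 + h s + h s'], and what remains only sees the design law. *)
Let cross s s' : (\int[data_law n f0]_y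
   (\1_(@design R d n @^-1` G) y * (lr f0 (h s) y * lr f0 (h s') y))%:E =
  \int[U]_t (\1_G t * expR (\sum_(i < n) h s (tnth t i) * h s' (tnth t i)))%:E)%E.
Proof.
pose e (t : n.-tuple (Defs.point R d)) :=
  expR (\sum_(i < n) h s (tnth t i) * h s' (tnth t i)).
have me : measurable_fun [set: n.-tuple (Defs.point R d)] e.
  apply: measurableT_comp => //; apply: measurable_sum => i.
  by apply: measurable_funM; apply: measurableT_comp => //; exact: measurable_tnth.
have mGe : measurable_fun [set: n.-tuple (Defs.point R d)]
    (fun t => (\1_G t * e t)%:E).
  by apply/measurable_EFinP; apply: measurable_funM => //; exact: measurable_indic.
have Ge0 t : (0 <= (\1_G t * e t)%:E)%E by rewrite lee_fin mulr_ge0// expR_ge0.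
pose hh : regfun R d := h s + h s'; pose g : regfun R d := f0 + hh.
have gE t : g t = f0 t + hh t by [].
have E1 := data_integral_design g mGe Ge0.
have E2 := data_integral_lr gE (measurableT_comp mGe md) (fun y => Ge0 (design y)).
apply: (etrans _ (etrans (esym E2) E1)).
apply: eq_integral => y _; rewrite -EFinM; congr (_%:E).
rewrite (@lr_mul R d n f0 (h s) (h s') hh y (fun=> erefl)) -mulrA.
rewrite [in RHS](mulrC (e _)).
by rewrite !indicE.
Qed.

(* [b] bounds the conditional chi-square divergence on the good designs [V <= K],
   and [v / K] the probability of the other ones. *)
Lemma avg_test_power_le (A : set (data R d n)) : measurable A ->
  (size S)%:R^-1 * \sum_(s <- S) fine (data_law n (f s) A) <=
  fine (data_law n f0 A) + Num.sqrt b + v / K.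
Proof.
move=> mA; pose m : R := (size S)%:R.
have m0 : 0 < m by rewrite ltr0n.
have mi0 : 0 <= m^-1 by rewrite invr_ge0 ltW.
(* This [k] minimizes [k + b / (4 * k)], whose minimum is [Num.sqrt b]; see [kcb]. *)
pose k : R := Num.sqrt b / 2; pose c : R := (4 * k)^-1.
have k0 : 0 < k by rewrite divr_gt0// sqrtr_gt0.
have c0 : 0 < c by rewrite invr_gt0 mulr_gt0.
pose D := @design R d n @^-1` G; pose B := A `&` D.
have mB : measurable B by exact: measurableI.
have pD (g : regfun R d) : data_law n g D = gam%:E by exact: pDG.
have mu_fin (g : regfun R d) X : measurable X ->
    data_law n g X = (fine (data_law n g X))%:E.
  by move=> mX; rewrite fineK// fin_num_measure.
have iI (g : regfun R d) X : measurable X ->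
    (\int[data_law n g]_y (\1_X y)%:E = (fine (data_law n g X))%:E)%E.
  by move=> mX; rewrite integral_indic// setIT; exact: mu_fin.
have mD : measurable D by exact: mDG.
have iD (g : regfun R d) : (\int[data_law n g]_y (\1_D y)%:E = gam%:E)%E.
  by rewrite iI// pD.
have mlr s : measurable_fun [set: data R d n] (lr f0 (h s)) by exact: measurable_lr.
have mI X : measurable X -> measurable_fun [set: data R d n] (\1_X : _ -> R).
  by move=> mX; exact: measurable_indic.
pose W (y : data R d n) := \1_B y + 2 * c * \1_D y.
have mW : measurable_fun [set: data R d n] W.
  by apply: measurable_funD; [exact: mI|apply: measurable_funM => //; exact: mI].
have W0 y : 0 <= W y by rewrite addr_ge0// mulr_ge0// mulr_ge0// ltW.
have intW (g : regfun R d) :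
    (\int[data_law n g]_y (W y)%:E = (fine (data_law n g B) + 2 * c * gam)%:E)%E.
  rewrite ge0_integral_EFinD//; last 2 first.
  - by apply: measurable_funM => //; exact: mI.
  - by move=> y; rewrite mulr_ge0// mulr_ge0// ltW.
  rewrite ge0_integral_EFinZl//; last by rewrite mulr_ge0// ltW.
  by rewrite iI// iD.
pose L (y : data R d n) : R := m^-1 * \sum_(s <- S) lr f0 (h s) y.
have L0 y : 0 <= L y.
  by rewrite mulr_ge0//; apply: sumr_ge0 => s _; exact: lr_ge0.
have mL : measurable_fun [set: data R d n] L.
  by apply: measurable_funM => //; exact: measurable_sum.
have intWL : (\int[data_law n f0]_y (W y * L y)%:E =
    (m^-1 * \sum_(s <- S) fine (data_law n (f s) B) + 2 * c * gam)%:E)%E.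
  transitivity (\int[data_law n f0]_y
      (\sum_(s <- S) m^-1 * (W y * lr f0 (h s) y))%:E)%E.
    apply: eq_integral => y _; congr (_%:E).
    by rewrite /L mulrCA mulr_sumr mulr_sumr.
  rewrite ge0_integral_EFin_sum; last 2 first.
  - move=> s; apply: measurable_funM => //; exact: measurable_funM.
  - by move=> s y; rewrite mulr_ge0// mulr_ge0//; exact: lr_ge0.
  under eq_bigr => s _.
    rewrite ge0_integral_EFinZl; last 3 first.
    - exact: measurable_funM.
    - by move=> y; rewrite mulr_ge0//; exact: lr_ge0.
    - exact: mi0.
    under eq_integral do rewrite EFinM.
    rewrite -(data_integral_lr (fE s) (F := EFin \o W)); last 2 first.
    - exact/measurable_EFinP.
    - by move=> y; rewrite /= lee_fin.
    rewrite intW -EFinM.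
    over.
  rewrite sumEFin; congr (_%:E); rewrite -mulr_sumr big_split/= mulrDr.
  congr (_ + _); rewrite sumr_const_seq.
  by rewrite mulKf// gt_eqF.
have intDL : (\int[data_law n f0]_y (\1_D y * L y ^+ 2)%:E <=
    ((1 + b) * gam)%:E)%E.
  have DL y : \1_D y * L y ^+ 2 = m^-1 ^+ 2 * \sum_(s <- S) \sum_(s' <- S)
      \1_D y * (lr f0 (h s) y * lr f0 (h s') y).
    rewrite /L exprMn mulrCA; congr (_ * _).
    rewrite expr2 mulr_suml mulr_sumr; apply: eq_bigr => s _.
    by rewrite mulr_sumr mulr_sumr.
  have mt s s' : measurable_fun [set: data R d n]
      (fun y => \1_D y * (lr f0 (h s) y * lr f0 (h s') y)).
    by apply: measurable_funM; [exact: mI|exact: measurable_funM].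
  have t0 s s' y : 0 <= (\1_D y : R) * (lr f0 (h s) y * lr f0 (h s') y).
    by rewrite !mulr_ge0//; exact: lr_ge0.
  under eq_integral do rewrite DL.
  rewrite ge0_integral_EFinZl; last 3 first.
  - by apply: measurable_sum => s; exact: measurable_sum.
  - by move=> y; apply: sumr_ge0 => s _; exact: sumr_ge0.
  - exact: exprn_ge0.
  rewrite ge0_integral_EFin_sum; last 2 first.
  - by move=> s; exact: measurable_sum.
  - by move=> s y; exact: sumr_ge0.
  under eq_bigr do rewrite ge0_integral_EFin_sum//.
  under eq_bigr do under eq_bigr do rewrite cross.
  pose e s s' (t : n.-tuple (Defs.point R d)) : R :=
    \1_G t * expR (\sum_(i < n) h s (tnth t i) * h s' (tnth t i)).
  have me s s' : measurable_fun [set: n.-tuple (Defs.point R d)] (e s s').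
    apply: measurable_funM; first exact: measurable_indic.
    apply: measurableT_comp => //; apply: measurable_sum => i.
    by apply: measurable_funM; apply: measurableT_comp => //; exact: measurable_tnth.
  have e0 s s' t : 0 <= e s s' t by rewrite mulr_ge0// expR_ge0.
  have -> : (\sum_(s <- S) \sum_(s' <- S) \int[U]_t (e s s' t)%:E =
      \int[U]_t (\sum_(s <- S) \sum_(s' <- S) e s s' t)%:E)%E.
    rewrite ge0_integral_EFin_sum; last 2 first.
    - by move=> s; exact: measurable_sum.
    - by move=> s y; exact: sumr_ge0.
    by apply: eq_bigr => s _; rewrite ge0_integral_EFin_sum.
  rewrite -ge0_integral_EFinZl; last 3 first.
  - by apply: measurable_sum => s; exact: measurable_sum.
  - by move=> y; apply: sumr_ge0 => s _; exact: sumr_ge0.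
  - exact: exprn_ge0.
  apply: (@le_trans _ _ (\int[U]_t ((1 + b) * \1_G t)%:E)%E).
    apply: ge0_le_integral_EFin.
    - apply: measurable_funM => //.
      by apply: measurable_sum => s; exact: measurable_sum.
    - by apply: measurable_funM => //; exact: measurable_indic.
    - move=> y; rewrite mulr_ge0 ?exprn_ge0//.
      by apply: sumr_ge0 => s _; exact: sumr_ge0.
    - move=> t; rewrite exprVn ler_pdivrMl ?exprn_gt0// /e indicE.
      under eq_bigr do rewrite -mulr_sumr.
      rewrite -mulr_sumr; have [tG|_] := boolP (t \in G).
        by rewrite mul1r mulr1 mulrC chi2//; rewrite inE in tG.
      by rewrite mul0r !mulr0.
  rewrite ge0_integral_EFinZl//; last by rewrite addr_ge0// ltW.
  by rewrite integral_indic// setIT EFinM /gam fineK// fin_num_measure.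
have mR1 : measurable_fun [set: data R d n] (fun y => (k + c) * \1_D y).
  by apply: measurable_funM => //; exact: mI.
have mL2 : measurable_fun [set: data R d n] (fun y => \1_D y * L y ^+ 2).
  by apply: measurable_funM; [exact: mI|exact: measurable_funX].
have mR2 : measurable_fun [set: data R d n] (fun y => c * (\1_D y * L y ^+ 2)).
  by apply: measurable_funM => //; exact: mI.
(* The pointwise inequality [L <= 1 + k + (L - 1)^2 / (4 k)], expanded and with the
   negative terms moved to the left, so that all integrands are nonnegative. *)
have key : m^-1 * \sum_(s <- S) fine (data_law n (f s) B) + 2 * c * gam <=
    fine (data_law n f0 B) + ((k + c) * gam + c * ((1 + b) * gam)).
  rewrite -lee_fin -intWL.
  apply: (@le_trans _ _ (\int[data_law n f0]_y (\1_B y + ((k + c) * \1_D y +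
      c * (\1_D y * L y ^+ 2)))%:E)%E).
    apply: ge0_le_integral_EFin.
    - exact: measurable_funM.
    - by apply: measurable_funD; [exact: mI|exact: measurable_funD].
    - by move=> y; rewrite mulr_ge0.
    - move=> y; rewrite /W !indicE in_setI; have [yD|_] := boolP (y \in D); last first.
        by rewrite andbF !(mulr0, mul0r, addr0).
      rewrite andbT mul1r !mulr1 -subr_ge0.
      have [yA|_] := boolP (y \in A).
        rewrite [leRHS](_ : _ = c * (L y - 1 - 2 * k) ^+ 2).
          by apply: mulr_ge0; [exact: ltW|exact: sqr_ge0].
        rewrite (_ : true%:R = 1 :> R)//.
        by rewrite /c; field; rewrite gt_eqF.
      rewrite [leRHS](_ : _ = c * (L y - 1) ^+ 2 + k); last first.
        by rewrite (_ : false%:R = 0 :> R)//; ring.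
      apply: addr_ge0; last exact: ltW.
      by apply: mulr_ge0; [exact: ltW|exact: sqr_ge0].
  have kc0 : 0 <= k + c by rewrite addr_ge0// ltW.
  have DL0 y : 0 <= (\1_D y : R) * L y ^+ 2 by rewrite mulr_ge0 ?exprn_ge0.
  have R20 y : 0 <= c * ((\1_D y : R) * L y ^+ 2) by rewrite mulr_ge0// ltW.
  have R10 y : 0 <= (k + c) * (\1_D y : R) by rewrite mulr_ge0.
  rewrite ge0_integral_EFinD//; last 2 first.
  - exact: measurable_funD.
  - by move=> y; rewrite addr_ge0.
  rewrite ge0_integral_EFinD// ge0_integral_EFinZl//.
  rewrite ge0_integral_EFinZl//; last exact: ltW.
  rewrite iI// iD -EFinM [leRHS]EFinD; apply: leeD2l.
  rewrite [leRHS]EFinD; apply: leeD2l.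
  by rewrite [leRHS]EFinM lee_pmul2l// lte_fin.
(* Markov's inequality: outside [D] one has [V > K], so [\1_A <= \1_B + V / K] everywhere. *)
have fB s : fine (data_law n (f s) A) <= fine (data_law n (f s) B) + v / K.
  have mVD : measurable_fun [set: data R d n] (fun y => K^-1 * V (design y)).
    by apply: measurable_funM => //; exact: measurableT_comp.
  rewrite -lee_fin.
  apply: (@le_trans _ _ (\int[data_law n (f s)]_y (\1_B y + K^-1 * V (design y))%:E)%E).
    rewrite -iI//.
    apply: ge0_le_integral_EFin => //.
    - exact: measurable_funD.
    - move=> y; rewrite !indicE in_setI; have [yD|yD] := boolP (y \in D).
        by rewrite andbT lerDl mulr_ge0// invr_ge0 ltW.
      rewrite andbF add0r; apply: (@le_trans _ _ 1); first by case: (_ \in _).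
      rewrite ler_pdivlMl// mulr1; apply/ltW; rewrite ltNge; apply/negP => VK.
      by move/negP: yD; apply; rewrite inE.
  rewrite ge0_integral_EFinD//; last by move=> y; rewrite mulr_ge0// invr_ge0 ltW.
  rewrite iI// EFinD leeD2l//.
  rewrite ge0_integral_EFinZl//; last 2 first.
  - exact: measurableT_comp.
  - by rewrite invr_ge0 ltW.
  rewrite (data_integral_design _ (F := fun t => (V t)%:E))//; last exact/measurable_EFinP.
  by rewrite mulrC EFinM lee_pmul2l// lte_fin invr_gt0.
have f0B : fine (data_law n f0 B) <= fine (data_law n f0 A).
  rewrite fine_le ?fin_num_measure//; apply: le_measure; rewrite ?inE//.
  by move=> y [].
have kcb : k + c * b = Num.sqrt b.
  have sb0 : 0 < Num.sqrt b by rewrite sqrtr_gt0.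
  rewrite -[X in c * X](sqr_sqrtr (ltW b0)) /c /k; field.
  by rewrite gt_eqF.
have avgB : m^-1 * \sum_(s <- S) fine (data_law n (f s) A) <=
    m^-1 * \sum_(s <- S) fine (data_law n (f s) B) + v / K.
  rewrite ler_pdivrMl// mulrDr mulrA divff ?gt_eqF// mul1r.
  apply: (@le_trans _ _ (\sum_(s <- S) (fine (data_law n (f s) B) + v / K))).
    exact: ler_sum.
  by rewrite big_split/= lerD2l sumr_const_seq.
apply: (le_trans avgB); rewrite lerD2r.
have gs : Num.sqrt b * gam <= Num.sqrt b by rewrite ler_piMr ?sqrtr_ge0//; case/andP: gam1.
have := key; rewrite -kcb mulrDl in gs *.
move=> key'; lra.
Qed.

End test_bound.

(** * Moments of random sign combinations *)

Section signs.
Context {R : realType}.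

Lemma cauchy_schwarz_seq (J : Type) (s : seq J) (a b : J -> R) :
  (\sum_(i <- s) a i * b i) ^+ 2 <=
  (\sum_(i <- s) a i ^+ 2) * (\sum_(i <- s) b i ^+ 2).
Proof.
elim: s => [|i s IH]; first by rewrite !big_nil expr0n mulr0.
rewrite !big_cons.
have A0 : 0 <= \sum_(j <- s) a j ^+ 2 by apply: sumr_ge0 => j _; exact: sqr_ge0.
have B0 : 0 <= \sum_(j <- s) b j ^+ 2 by apply: sumr_ge0 => j _; exact: sqr_ge0.
move: IH A0 B0; set A := \sum_(j <- s) a j ^+ 2; set B := \sum_(j <- s) b j ^+ 2.
set X := \sum_(j <- s) _ => IH A0 B0.
suff : 2 * (a i * b i * X) <= a i ^+ 2 * B + b i ^+ 2 * A by move=> ?; nra.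
have [A00|A00] := eqVneq A 0.
  have -> : X = 0.
    by apply/eqP; rewrite -sqrf_eq0 eq_le sqr_ge0 andbT (le_trans IH)// A00 mul0r.
  by rewrite mulr0 mulr0 A00 mulr0 addr0 mulr_ge0// sqr_ge0.
have {A00}A0' : 0 < A by rewrite lt_neqAle eq_sym A00.
rewrite -(ler_pM2l A0') -subr_ge0.
have := sqr_ge0 (a i * X - b i * A).
have : a i ^+ 2 * X ^+ 2 <= a i ^+ 2 * (A * B) by rewrite ler_wpM2l ?sqr_ge0.
nra.
Qed.

(** The sharp exponent is [x ^+ 2 / 2]; the weaker one follows from [1 + y <= expR y] alone. For
    [x >= 1 / 2] it already exceeds [x]. For [|y| < 1 / 2], [expR y <= (1 - y)^-1 <= 1 + y + 2 * y
    ^+ 2], and the linear terms cancel in the sum. *)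
Lemma cosh_le_expR (x : R) : expR x + expR (- x) <= 2 * expR (2 * x ^+ 2).
Proof.
wlog x0 : x / 0 <= x => [H|].
  have [/H//|x0] := leP 0 x.
  by have := H (- x); rewrite oppr_ge0 opprK sqrrN addrC => /(_ (ltW x0)).
have [x2|x2] := leP (1 / 2) x.
  have e1 : expR (- x) <= expR x by rewrite ler_expR; lra.
  have e2 : expR x <= expR (2 * x ^+ 2) by rewrite ler_expR; nra.
  lra.
have ineq (y : R) : - (1 / 2) < y -> y < 1 / 2 -> expR y <= 1 + y + 2 * y ^+ 2.
  move=> y1 y2; have y3 : 0 < 1 - y by lra.
  have := expR_ge1Dx (- y) => h.
  have : expR y * (1 - y) <= 1.
    by rewrite -[leRHS](expRxMexpNx_1 y) ler_pM2l ?expR_gt0.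
  have := expR_gt0 y => e0 h2.
  rewrite -(ler_pM2r y3) (le_trans h2)//.
  by have := sqr_ge0 y; nra.
have H1 : expR x <= 1 + x + 2 * x ^+ 2 by apply: ineq => //; lra.
have H2 : expR (- x) <= 1 + - x + 2 * (- x) ^+ 2 by apply: ineq; lra.
rewrite sqrrN in H2.
by have := expR_ge1Dx (2 * x ^+ 2); lra.
Qed.

(** Uniform random signs as an enumeration: averages become sums over this list, treated by
    induction on the first sign. *)
Fixpoint signs (n : nat) : seq (seq R) :=
  if n is n'.+1 then map (cons 1) (signs n') ++ map (cons (- 1)) (signs n')
  else [:: [::]].

Lemma size_signs n : size (signs n) = (2 ^ n)%N.
Proof.
by elim: n => //= n IH; rewrite size_cat !size_map IH expnS mul2n addnn.
Qed.

Lemma big_signsS n (F : seq R -> R) :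
  \sum_(s <- signs n.+1) F s = \sum_(s <- signs n) (F (1 :: s) + F (- 1 :: s)).
Proof. by rewrite /= big_cat/= !big_map big_split. Qed.

Lemma mem_signs n s : s \in signs n ->
  size s = n /\ forall k, (k < n)%N -> s`_k ^+ 2 = 1.
Proof.
elim: n s => [|n IH] s /=; first by rewrite inE => /eqP ->.
rewrite mem_cat => /orP[] /mapP[s' /IH[ss' s'1] ->] /=; (split; first by rewrite ss');
  case=> [|k] kn /=; by rewrite ?sqrrN ?expr1n// s'1.
Qed.

(** The coefficients are indexed by [nat], so that dropping the first sign amounts to composing [u]
    with [S]. *)
Definition signed_sum (s : seq R) (u : nat -> R) := \sum_(k < size s) s`_k * u k.

Lemma signed_sum_cons b s u :
  signed_sum (b :: s) u = b * u 0 + signed_sum s (u \o S).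
Proof. by rewrite /signed_sum/= big_ord_recl. Qed.

Lemma signs_expR n u : \sum_(s <- signs n) expR (signed_sum s u) <=
  2 ^+ n * expR (2 * \sum_(k < n) u k ^+ 2).
Proof.
elim: n u => [|n IH] u.
  by rewrite big_seq1 /signed_sum !big_ord0 mulr0 mul1r.
rewrite big_signsS big_ord_recl mulrDr expRD exprS.
under eq_bigr do rewrite !signed_sum_cons !expRD -mulrDl mul1r mulN1r.
rewrite -mulr_sumr mulrACA ler_pM ?addr_ge0 ?expR_ge0//.
- by apply: sumr_ge0 => s _; exact: expR_ge0.
- exact: cosh_le_expR.
Qed.

(* Averaging over the first sign turns the cross term into an extra row; this
   row costs at most half of the first column, because the total is small. *)
Lemma signs_expR_quad n (rows : seq (nat -> R)) :
  \sum_(r <- rows) \sum_(k < n) r k ^+ 2 <= 32^-1 ->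
  \sum_(s <- signs n) expR (2 * \sum_(r <- rows) signed_sum s r ^+ 2) <=
  2 ^+ n * expR (4 * \sum_(r <- rows) \sum_(k < n) r k ^+ 2).
Proof.
elim: n rows => [|n IH] rows.
  move=> _; rewrite big_seq1 mul1r !big1 ?mulr0// => r _.
    by rewrite /signed_sum !big_ord0.
  by rewrite /signed_sum !big_ord0 expr0n.
(* The cross term of [2 * \sum_r (+- r 0 + ...) ^+ 2] is [+- 4 * x], and [cosh_le_expR] replaces it
   by [2 * (4 * x) ^+ 2]. This is the contribution, with the common weight 2, of one more row
   [r0]. *)
pose r0 (k : nat) := 4 * \sum_(r <- rows) r 0 * r k.+1.
pose rows' := r0 :: [seq r \o S | r <- rows].
under eq_bigr do rewrite big_ord_recl; rewrite big_split/=.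
set w := \sum_(r <- rows) r 0 ^+ 2.
set t1 := \sum_(r <- rows) \sum_(k < n) _ => tle.
have w0 : 0 <= w by apply: sumr_ge0 => r _; exact: sqr_ge0.
have t10 : 0 <= t1.
  by apply: sumr_ge0 => r _; apply: sumr_ge0 => k _; exact: sqr_ge0.
(* By Cauchy-Schwarz the row [r0] has squared norm at most [16 * w * t1], and [t1 <= 32^-1] makes
   this at most [w / 2]. In particular the new total stays below [32^-1], as the induction
   requires. *)
have trows' : \sum_(r <- rows') \sum_(k < n) r k ^+ 2 <= w / 2 + t1.
  rewrite big_cons big_map lerD2r.
  apply: (@le_trans _ _ (16 * (w * t1))); last by nra.
  rewrite /t1 exchange_big/= !mulr_sumr; apply: ler_sum => k _.
  by rewrite /r0 exprMn -natrX ler_pM2l//; exact: cauchy_schwarz_seq.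
rewrite big_signsS exprS.
have step s : expR (2 * \sum_(r <- rows) signed_sum (1 :: s) r ^+ 2) +
    expR (2 * \sum_(r <- rows) signed_sum (- 1 :: s) r ^+ 2) <=
    2 * expR (2 * w) * expR (2 * \sum_(r <- rows') signed_sum s r ^+ 2).
  rewrite big_cons big_map.
  set l := \sum_(r <- rows) signed_sum s (r \o S) ^+ 2.
  have -> : signed_sum s r0 = 4 * \sum_(r <- rows) r 0 * signed_sum s (r \o S).
    rewrite /signed_sum /r0; under eq_bigr do rewrite mulrCA mulr_sumr.
    rewrite -mulr_sumr exchange_big; congr (_ * _); apply: eq_bigr => r _.
    by rewrite mulr_sumr; apply: eq_bigr => k _; rewrite mulrCA.
  set x := \sum_(r <- rows) r 0 * _.
  have E (e : R) : e ^+ 2 = 1 ->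
      \sum_(r <- rows) signed_sum (e :: s) r ^+ 2 = w + (2 * e * x + l).
    move=> e1; rewrite /w /x /l mulr_sumr -!big_split/=; apply: eq_bigr => r _.
    by rewrite signed_sum_cons sqrrD exprMn e1 mul1r -addrA; congr (_ + (_ + _));
      ring.
  rewrite !E ?sqrrN ?expr1n//.
  have := cosh_le_expR (4 * x) => h.
  rewrite !mulrDr !expRD.
  have e1 := expR_gt0 (2 * w); have e2 := expR_gt0 (2 * l).
  rewrite (_ : 2 * (2 * 1 * x) = 4 * x); last by ring.
  rewrite (_ : 2 * (2 * -1 * x) = - (4 * x)); last by ring.
  rewrite [leLHS](_ : _ = expR (2 * w) * expR (2 * l) *
    (expR (4 * x) + expR (- (4 * x)))); last by ring.
  rewrite [leRHS](_ : _ = expR (2 * w) * expR (2 * l) *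
    (2 * expR (2 * (4 * x) ^+ 2))); last by ring.
  by rewrite ler_pM2l ?mulr_gt0.
apply: (le_trans (ler_sum _ (fun s _ => step s))).
rewrite -mulr_sumr.
have t'le : \sum_(r <- rows') \sum_(k < n) r k ^+ 2 <= 32^-1 by lra.
have e0 : 0 <= 2 * expR (2 * w) by rewrite mulr_ge0 ?expR_ge0.
apply: (le_trans (ler_wpM2l e0 (IH _ t'le))).
(* The exponents add up without loss: [2 * w + 4 * (w / 2 + t1) = 4 * (w + t1)]. *)
rewrite mulrACA ler_pM2l ?mulr_gt0 ?exprn_gt0// -expRD ler_expR; lra.
Qed.

Lemma signs_sqr n u : \sum_(s <- signs n) signed_sum s u ^+ 2 =
  2 ^+ n * \sum_(k < n) u k ^+ 2.
Proof.
elim: n u => [|n IH] u.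
  by rewrite big_seq1 /signed_sum !big_ord0 expr0n mulr0.
rewrite big_signsS big_ord_recl.
rewrite (eq_bigr (fun s => 2 * u 0 ^+ 2 + 2 * signed_sum s (u \o S) ^+ 2)); last first.
  by move=> s _; rewrite !signed_sum_cons; ring.
rewrite big_split/= sumr_const_seq -mulr_sumr IH size_signs natrX (exprS _ n).
by set t := \sum_(k < n) (u \o S) k ^+ 2; rewrite -/t; ring.
Qed.

(** Khintchine's inequality for the fourth moment. Averaging over the first sign leaves the cross
    term [12 * u 0 ^+ 2 * t], which the constant 3 matches exactly; only the term in [u 0 ^+ 4] has
    slack. *)
Lemma signs_pow4 n u : \sum_(s <- signs n) signed_sum s u ^+ 4 <=
  2 ^+ n * (3 * (\sum_(k < n) u k ^+ 2) ^+ 2).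
Proof.
elim: n u => [|n IH] u.
  by rewrite big_seq1 /signed_sum !big_ord0 !expr0n !mulr0.
rewrite big_signsS big_ord_recl.
rewrite (eq_bigr (fun s => 2 * u 0 ^+ 4 +
    (12 * u 0 ^+ 2 * signed_sum s (u \o S) ^+ 2 +
     2 * signed_sum s (u \o S) ^+ 4))); last first.
  by move=> s _; rewrite !signed_sum_cons; ring.
rewrite !big_split/= sumr_const_seq -!mulr_sumr signs_sqr size_signs natrX (exprS _ n).
have := IH (u \o S); set X := \sum_(s <- _) _; set t := \sum_(k < n) (u \o S) k ^+ 2.
have : 0 < 2 ^+ n :> R by rewrite exprn_gt0.
set p := 2 ^+ n => p0 H.
have := mulr_ge0 (ltW p0) (sqr_ge0 (u 0 ^+ 2)).
nra.
Qed.

End signs.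

(** * Finite combinations of the basis functions *)

Section Lq.
Context {R : realType} {d : nat}.
Notation pt := (Defs.point R d).
Notation U := (@unif R d).
Implicit Types g : pt -> R.

Lemma LqNormE n g :
  LqNorm n%:R g = ((\int[U]_t (`|g t| ^+ n)%:E) `^ n%:R^-1)%E.
Proof.
rewrite /LqNorm unlock; congr (_ `^ _)%E; apply: eq_integral => t _.
transitivity ((`|g t|%:E) `^ n%:R)%E; first by [].
by rewrite poweR_EFin powR_mulrn.
Qed.

Lemma LqNorm_lty n g : (0 < n)%N -> (LqNorm n%:R g < +oo)%E -> (\int[U]_t (`|g t| ^+ n)%:E < +oo)%E.
Proof.
move=> n0; rewrite LqNormE; apply: lty_poweRy.
by rewrite invr_eq0 pnatr_eq0 -lt0n.
Qed.

Lemma lty_LqNorm n g : (\int[U]_t (`|g t| ^+ n)%:E < +oo)%E ->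
  (LqNorm n%:R g < +oo)%E.
Proof. by move=> h; rewrite LqNormE; exact: poweR_lty. Qed.

Lemma le_LqNorm n g (C : R) : (0 < n)%N -> 0 <= C ->
  (\int[U]_t (`|g t| ^+ n)%:E <= (C ^+ n)%:E)%E -> (LqNorm n%:R g <= C%:E)%E.
Proof.
move=> n0 C0 h; rewrite LqNormE.
have h0 : (0 <= \int[U]_t (`|g t| ^+ n)%:E)%E.
  by apply: integral_ge0 => t _; rewrite lee_fin exprn_ge0.
have -> : C%:E = (((C ^+ n)%:E) `^ n%:R^-1)%E.
  rewrite poweR_EFin -powR_mulrn// -powRrM mulfV ?pnatr_eq0 -?lt0n//.
  by rewrite powRr1.
apply: gt0_ler_poweR => //; rewrite in_itv/= ?h0 ?leey//.
by rewrite lee_fin exprn_ge0// leey.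
Qed.

Lemma ge0_integrable_fin g : measurable_fun [set: pt] g -> (forall t, 0 <= g t) ->
  (\int[U]_t (g t)%:E < +oo)%E -> U.-integrable [set: pt] (EFin \o g).
Proof.
move=> mg g0 h; apply/integrableP; split; first exact/measurable_EFinP.
by under eq_integral do rewrite /= ger0_norm//.
Qed.

Lemma Rintegral_sum (J : Type) (s : seq J) (b : J -> R) (g : J -> pt -> R) :
  (forall i, U.-integrable [set: pt] (EFin \o g i)) ->
  \int[U]_t (\sum_(i <- s) b i * g i t) = \sum_(i <- s) b i * \int[U]_t (g i t).
Proof.
move=> ig.
have igZ i : U.-integrable [set: pt] (EFin \o (fun t => b i * g i t)).
  rewrite (_ : _ \o _ = fun t => ((b i)%:E * (EFin \o g i) t)%E).
    exact: integrableZl.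
  by apply/funext => t /=; rewrite EFinM.
elim: s => [|i s IH].
  under eq_Rintegral do rewrite big_nil.
  by rewrite big_nil Rintegral_cst// mul0r.
under eq_Rintegral do rewrite big_cons.
rewrite big_cons RintegralD//; first by rewrite RintegralZl// IH.
rewrite (_ : _ \o _ = fun t => (\sum_(j <- s) (EFin \o (fun t => b j * g j t)%R) t)%E).
  exact: integrable_sum.
by apply/funext => t /=; rewrite sumEFin.
Qed.

End Lq.

Lemma big_uniq_supp (R : nmodType) (I : eqType) (r r' : seq I) (F : I -> R) :
  uniq r -> uniq r' -> {subset r <= r'} -> (forall i, i \notin r -> F i = 0) ->
  \sum_(i <- r') F i = \sum_(i <- r) F i.
Proof.
move=> ur ur' rr' F0; rewrite (bigID (mem r))/= [X in _ + X]big1// addr0.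
rewrite -big_filter; apply: perm_big; apply: uniq_perm => //.
  exact: filter_uniq.
by move=> i; rewrite mem_filter; case: (boolP (i \in r)) => //= /rr'.
Qed.

Section finite_combination.
Context {R : realType} {d : nat} {I : countType} (phi : I -> regfun R d).
Notation pt := (Defs.point R d).
Notation U := (@unif R d).

Definition comb (J : seq I) (b : I -> R) (t : pt) : R :=
  \sum_(l <- J) b l * phi l t.

Lemma measurable_comb J b : measurable_fun [set: pt] (comb J b).
Proof. by apply: measurable_sum => l; exact: measurable_funM. Qed.

HB.instance Definition _ J b :=
  isMeasurableFun.Build _ _ _ _ (comb J b) (measurable_comb J b).

Hypothesis hphi : orthonormal_basis phi.
Variables (c q : I -> R) (J : seq I) (b : I -> R).
Hypothesis uJ : uniq J.

Lemma basis_sqr_lty l : (\int[U]_t (phi l t ^+ 2)%:E < +oo)%E.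
Proof.
case: hphi => /(_ l)[h _] _ _.
under eq_integral do rewrite -real_normK ?num_real//.
exact: (@LqNorm_lty _ _ 2).
Qed.

Lemma basis_mul_integrable l m :
  U.-integrable [set: pt] (EFin \o (fun t => phi l t * phi m t)).
Proof.
have ms k : measurable_fun [set: pt] (fun t => phi k t ^+ 2) by exact: measurable_funX.
apply: (@le_integrable _ _ _ U _ measurableT _
  (EFin \o (fun t => phi l t ^+ 2 + phi m t ^+ 2))).
- by apply/measurable_EFinP; exact: measurable_funM.
- move=> t _ /=; rewrite lee_fin normrM [leRHS]ger0_norm ?addr_ge0 ?sqr_ge0//.
  rewrite -(real_normK (num_real (phi l t))) -(real_normK (num_real (phi m t))).
  have := sqr_ge0 (`|phi l t| - `|phi m t|).
  by have := normr_ge0 (phi l t); have := normr_ge0 (phi m t); nra.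
- apply: ge0_integrable_fin.
  + exact: measurable_funD.
  + by move=> t; rewrite addr_ge0// sqr_ge0.
  + rewrite ge0_integral_EFinD//; try by move=> t; exact: sqr_ge0.
    by rewrite lte_add_pinfty// basis_sqr_lty.
Qed.

Lemma basis_integrable l : U.-integrable [set: pt] (EFin \o phi l).
Proof.
have ms k : measurable_fun [set: pt] (fun t => phi k t ^+ 2) by exact: measurable_funX.
apply: (@le_integrable _ _ _ U _ measurableT _
  (EFin \o (fun t => 1 + phi l t ^+ 2))).
- exact/measurable_EFinP.
- move=> t _ /=; rewrite lee_fin [leRHS]ger0_norm ?addr_ge0 ?sqr_ge0//.
  rewrite -(real_normK (num_real (phi l t))).
  by have := sqr_ge0 (`|phi l t| - 1); have := normr_ge0 (phi l t); nra.
- apply: ge0_integrable_fin.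
  + exact: measurable_funD.
  + by move=> t; rewrite addr_ge0// sqr_ge0.
  + rewrite ge0_integral_EFinD//; last by move=> t; exact: sqr_ge0.
    rewrite integral_cst//= probability_setT mule1.
    by rewrite lte_add_pinfty ?ltry// basis_sqr_lty.
Qed.

Lemma coef_comb l : coef phi (comb J b) l = if l \in J then b l else 0.
Proof.
case: hphi => _ ortho _; rewrite /coef /comb.
under eq_Rintegral do rewrite mulr_suml.
under eq_Rintegral do under eq_bigr do rewrite -mulrA.
rewrite (Rintegral_sum _ _ (fun m => basis_mul_integrable m l)).
under eq_bigr do rewrite ortho.
case: ifPn => lJ.
  rewrite (bigD1_seq l)//= eqxx mulr1 big1 ?addr0// => m /negPf ->.
  by rewrite mulr0.
rewrite big1_seq// => m /andP[_ mJ].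
by case: eqP => [E|]; [rewrite -E mJ in lJ|rewrite mulr0].
Qed.

Lemma comb_L2_centered : L2_centered (comb J b).
Proof.
case: (hphi) => cen _ _; split; last first.
  rewrite /comb (Rintegral_sum _ _ basis_integrable) big1// => l _.
  by case: (cen l) => _ ->; rewrite mulr0.
apply: (@lty_LqNorm _ _ 2).
under eq_integral do rewrite real_normK ?num_real//.
pose B := \sum_(l <- J) b l ^+ 2.
have B0 : 0 <= B by apply: sumr_ge0 => l _; exact: sqr_ge0.
have ms k : measurable_fun [set: pt] (fun t => phi k t ^+ 2) by exact: measurable_funX.
apply: (@le_lt_trans _ _ (\int[U]_t (B * \sum_(l <- J) phi l t ^+ 2)%:E)%E).
  apply: ge0_le_integral_EFin.
  - by apply: measurable_funX; exact: measurable_comb.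
  - by apply: measurable_funM => //; exact: measurable_sum.
  - by move=> t; exact: sqr_ge0.
  - by move=> t; exact: cauchy_schwarz_seq.
rewrite ge0_integral_EFinZl//; last 2 first.
- exact: measurable_sum.
- by move=> t; apply: sumr_ge0 => l _; exact: sqr_ge0.
rewrite ge0_integral_EFin_sum//; last by move=> l t; exact: sqr_ge0.
rewrite lte_mul_pinfty//.
by apply/lte_sum_pinfty => l _; exact: basis_sqr_lty.
Qed.

(** As soon as the index set contains [J], the remainder vanishes identically. *)
Lemma comb_expands : expands phi (comb J b).
Proof.
move=> e e0; exists [fset l in J]%fset => J' JJ'.
rewrite (_ : (fun t => _) = cst 0); first by rewrite /LqNorm Lnorm0// lte_fin.
apply/funext => t /=; apply/eqP; rewrite subr_eq0; apply/eqP/esym.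
rewrite (big_uniq_supp (r := J))//.
- by rewrite /comb big_seq [RHS]big_seq; apply: eq_bigr => l lJ; rewrite coef_comb lJ.
- exact: fset_uniq.
- by move=> l lJ; apply: (fsubsetP JJ'); rewrite inE.
- by move=> l lJ; rewrite coef_comb (negPf lJ) mul0r.
Qed.

Lemma esum_coef_comb (w : I -> R) (A : set I) : (forall l, A l -> 0 <= w l) ->
  (\esum_(l in A) (w l * coef phi (comb J b) l ^+ 2)%:E =
   (\sum_(l <- J | l \in A) w l * b l ^+ 2)%:E)%E.
Proof.
move=> w0; transitivity (\esum_(l in A `&` [set` J])
    (w l * coef phi (comb J b) l ^+ 2)%:E)%E.
  rewrite esum_mkcondr; apply: eq_esum => l _; case: ifPn => //.
  by rewrite notin_setE/= coef_comb => /negP/negPf ->; rewrite expr0n mulr0.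
rewrite esum_fset; last 2 first.
- by apply: finite_setIr; exact: finite_seq.
- by move=> l; rewrite inE => -[Al _]; rewrite lee_fin mulr_ge0 ?w0// sqr_ge0.
rewrite (@fsbigE _ _ _ _ _ [seq l <- J | l \in A]); last 3 first.
- exact: filter_uniq.
- by move=> l /=; rewrite mem_filter => /andP[]; rewrite inE.
- move=> l [Al lJ]; rewrite mem_filter negb_and => /orP[/negP|/negP]//.
  by rewrite inE.
rewrite big_filter_cond big_mkcond [in RHS]big_mkcond -sumEFin/=.
rewrite big_seq [in RHS]big_seq; apply: eq_bigr => l lJ.
rewrite in_setI coef_comb lJ; case: ifPn => /andP.
  by case=> [-> _].
case: ifPn => // lA [].
by split=> //=; rewrite mem_set.
Qed.

Lemma Q_comb : Q phi q (comb J b) = \sum_(l <- J) q l * b l ^+ 2.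
Proof.
rewrite /Q esum_coef_comb; last by move=> l /ltW.
rewrite (esum_coef_comb (w := fun l => - q l)); last first.
  by move=> l; rewrite oppr_ge0 => /ltW.
rewrite /= big_mkcond [X in _ - X]big_mkcond -sumrB; apply: eq_bigr => l _.
have [q0|q0|q0] := ltgtP (q l) 0.
- rewrite memNset; last by move=> /= h; have := lt_trans h q0; rewrite ltxx.
  by rewrite mem_set//= sub0r mulNr opprK.
- rewrite mem_set// memNset ?subr0// => /= h.
  by have := lt_trans h q0; rewrite ltxx.
- by rewrite q0 oppr0 !mul0r !if_same subr0.
Qed.

Lemma TQ_comb T t : TQ phi c q T (comb J b) t =
  \sum_(l <- J) (if l \in NT c q T then q l else 0) * b l * phi l t.
Proof.
rewrite /TQ (@fsbigE _ _ _ _ _ [seq l <- J | l \in NT c q T]); last 3 first.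
- exact: filter_uniq.
- by move=> l /=; rewrite mem_filter => /andP[]; rewrite inE.
- move=> l Tl; rewrite mem_filter mem_set//= => /negPf lJ.
  by rewrite coef_comb lJ mulr0 mul0r.
rewrite big_filter_cond big_mkcond/=.
rewrite big_seq [in RHS]big_seq; apply: eq_bigr => l lJ.
by rewrite coef_comb lJ andbb; case: ifP => //; rewrite !mul0r.
Qed.

Lemma measurable_TQ_comb T : measurable_fun [set: pt] (TQ phi c q T (comb J b)).
Proof.
rewrite (_ : TQ _ _ _ _ _ = fun t => \sum_(l <- J)
  ((if l \in NT c q T then q l else 0) * b l) * phi l t); last first.
  by apply/funext => t; exact: TQ_comb.
by apply: measurable_sum => l; exact: measurable_funM.
Qed.

(** For finite combinations, membership in the class reduces to one finite sum and two integrals of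
    polynomials in the basis functions, which can then be averaged over the prior. *)
Lemma Sigma_comb (L T : R) : (forall l, 0 <= c l) -> 0 <= L ->
  \sum_(l <- J) c l * b l ^+ 2 <= 1 ->
  (\int[U]_t (comb J b t ^+ 4)%:E <= (L ^+ 4)%:E)%E ->
  (\int[U]_t ((comb J b t * TQ phi c q T (comb J b) t) ^+ 2)%:E <= (L ^+ 2)%:E)%E ->
  Sigma phi c q L T (comb J b).
Proof.
move=> c0 L0 c1 h4 h2; split.
- exact: comb_L2_centered.
- exact: comb_expands.
- rewrite esum_coef_comb//.
  by under eq_bigl do rewrite in_setT; rewrite lee_fin.
- rewrite ge_max; apply/andP; split.
    apply: (@le_LqNorm _ _ 4) => //.
    under eq_integral do rewrite -normrX ger0_norm ?exprn_even_ge0//.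
    exact: h4.
  apply: (@le_LqNorm _ _ 2) => //.
  under eq_integral do rewrite real_normK ?num_real//.
  exact: h2.
Qed.

End finite_combination.

(** * From tests to the minimax risk; expectations over the design *)

Section minimax.
Context {R : realType} {d : nat}.

(** The average over the prior may include functions outside [A1]. The weight [w] is at least 1 at
    these, hence exceeds any error probability there, so that they cost at most the average [e] of
    [w]. *)
Lemma minimax_risk_ge (J : eqType) n (A0 A1 : set (regfun R d)) (f0 : regfun R d)
    (S : seq J) (f : J -> regfun R d) (w : J -> R) (r e : R) :
  A0 f0 -> (0 < size S)%N -> (forall s, 0 <= w s) ->
  (forall s, s \in S -> A1 (f s) \/ 1 <= w s) ->
  (size S)%:R^-1 * \sum_(s <- S) w s <= e ->
  (forall A : set (data R d n), measurable A ->
    (size S)%:R^-1 * \sum_(s <- S) fine (data_law n (f s) A) <=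
    fine (data_law n f0 A) + r) ->
  1 - r - e <= minimax_risk n A0 A1.
Proof.
move=> A0f0 S0 w0 A1f we test.
have m0 : 0 < (size S)%:R :> R by rewrite ltr0n.
have P01 (g : regfun R d) A : measurable A -> 0 <= fine (data_law n g A) <= 1.
  move=> mA; rewrite fine_ge0//= -lee_fin fineK ?fin_num_measure//.
  exact: probability_le1.
apply: lb_le_inf.
  pose phi0 : {mfun data R d n >-> bool} := cst true.
  by eexists; exists phi0.
move=> _ [phi _ <-].
have mphi : measurable [set y | phi y].
  rewrite (_ : [set y | phi y] = phi @^-1` [set true]); last first.
    by apply/seteqP; split => y /= ->.
  by rewrite -[X in measurable X]setTI; exact: measurable_funP.
have mphiN : measurable [set y | ~~ phi y].
  rewrite (_ : [set y | ~~ phi y] = ~` [set y | phi y]); first exact: measurableC.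
  by apply/seteqP; split => y /= /negP.
set E0 := [set fine (data_law n g [set y | phi y]) | g in A0].
set E1 := [set fine (data_law n g [set y | ~~ phi y]) | g in A1].
have h0 : fine (data_law n f0 [set y | phi y]) <= sup E0.
  apply: ub_le_sup; last by exists f0.
  by exists 1 => _ [g _ <-]; case/andP: (P01 g _ mphi).
have h1 g : A1 g -> fine (data_law n g [set y | ~~ phi y]) <= sup E1.
  move=> A1g; apply: ub_le_sup; last by exists g.
  by exists 1 => _ [g' _ <-]; case/andP: (P01 g' _ mphiN).
(* If [A1] is empty, the supremum takes its default value 0. *)
have h10 : 0 <= sup E1.
  have [->|/set0P[_ [g A1g _]]] := eqVneq E1 set0; first by rewrite sup0.
  by rewrite (le_trans _ (h1 g A1g))//; case/andP: (P01 g _ mphiN).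
have phiE g : fine (data_law n g [set y | phi y]) =
    1 - fine (data_law n g [set y | ~~ phi y]).
  have -> : [set y | phi y] = ~` [set y | ~~ phi y].
    by apply/seteqP; split => y /=; [move=> ->|move/negP; rewrite negbK].
  rewrite probability_setC// fineB ?fin_num_measure//.
have := test _ mphi.
under eq_bigr do rewrite phiE.
rewrite sumrB sumr_const_seq mulr1 mulrBr mulVf ?gt_eqF//.
suff : (size S)%:R^-1 * \sum_(s <- S) fine (data_law n (f s) [set y | ~~ phi y]) <=
    sup E1 + e by lra.
apply: (@le_trans _ _ ((size S)%:R^-1 * \sum_(s <- S) (sup E1 + w s))).
  rewrite ler_pM2l ?invr_gt0// big_seq [leRHS]big_seq; apply: ler_sum => s sS.
  have [/h1 h|w1] := A1f s sS; first by rewrite (le_trans h)// lerDl.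
  have /andP[_ h] := P01 (f s) _ mphiN.
  by rewrite (le_trans h)// (le_trans w1)// lerDr.
by rewrite big_split/= sumr_const_seq mulrDr mulKf ?gt_eqF// lerD2l.
Qed.

End minimax.

Section design_expectation.
Context {R : realType} {d : nat}.
Notation pt := (Defs.point R d).
Notation U := (@unif R d).

Lemma unif_cube : U (@cube R d) = 1%E.
Proof.
pose A : set R := `[0, 1]%classic.
have -> : @cube R d = [set t : pt | forall i, A (tnth t i)].
  by apply/seteqP; split => t /= h i; have := h i; rewrite /A/= in_itv.
rewrite /unif (iid_probE _ (A := fun=> (A : set (measurableTypeR R)))); last first.
  by move=> i; exact: measurable_itv.
rewrite big1// => i _; rewrite /= /uniform_prob.
by rewrite integral_uniform_pdf1.
Qed.

Lemma measurable_cube : measurable (@cube R d).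
Proof.
pose A : set R := `[0, 1]%classic.
have -> : @cube R d = \bigcap_(i in [set: 'I_d]) ((fun t : pt => tnth t i) @^-1` A).
  apply/seteqP; split => t /= h i; last by have := h i I; rewrite /A/= in_itv.
  by move=> _; have := h i; rewrite /A/= in_itv.
apply: fin_bigcap_measurable => // i _.
rewrite -[X in measurable X]setTI; apply: measurable_tnth => //.
exact: measurable_itv.
Qed.

(** Bounds such as [D6] hold on the cube only, whereas [unif] is a measure on the whole space; the
    cube carries all its mass. *)
Lemma le_integral_cube (f g : pt -> \bar R) :
  measurable_fun [set: pt] f -> measurable_fun [set: pt] g ->
  (forall t, 0 <= f t)%E -> (forall t, 0 <= g t)%E ->
  (forall t, cube t -> f t <= g t)%E ->
  (\int[U]_t f t <= \int[U]_t g t)%E.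
Proof.
move=> mf mg f0 g0 fg; apply: ae_ge0_le_integral => //.
exists (~` @cube R d); split.
- by apply: measurableC; exact: measurable_cube.
- by have := probability_setC U measurable_cube; rewrite unif_cube subee.
- by move=> t /= h ct; apply: h => _; exact: fg.
Qed.

Lemma iid_integral_sum d' (T : measurableType d') (P : probability T R) n
    (g : T -> R) : measurable_fun [set: T] g -> (forall x, 0 <= g x) ->
  (\int[iid_prob P n]_w (\sum_(i < n) g (tnth w i))%:E =
   n%:R%:E * \int[P]_x (g x)%:E)%E.
Proof.
move=> mg g0.
have ms m : measurable_fun [set: m.-tuple T] (fun w => \sum_(i < m) g (tnth w i)).
  apply: measurable_sum => i.
  by apply: measurableT_comp => //; exact: measurable_tnth.
elim: n => [|n IH].
  by under eq_integral do rewrite big_ord0; rewrite integral0 mul0e.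
rewrite iid_integralS; last 2 first.
- by apply/measurable_EFinP; exact: ms.
- by move=> w; rewrite lee_fin sumr_ge0.
under eq_integral => x _.
  under eq_integral => w _.
    rewrite big_ord_recl (_ : tnth _ ord0 = x)// (eq_bigr (fun i => g (tnth w i))); last first.
      by move=> i _; rewrite tnthS.
    over.
  rewrite ge0_integral_EFinD//; last 2 first.
  - exact: ms.
  - by move=> w; exact: sumr_ge0.
  rewrite integral_cst//= probability_setT mule1 IH.
  over.
rewrite ge0_integralD//; last 3 first.
- by move=> x _; rewrite lee_fin.
- exact/measurable_EFinP.
- by move=> x _; rewrite mule_ge0// integral_ge0// => y _; rewrite lee_fin.
rewrite [X in (_ + X)%E]integral_cst//= probability_setT mule1.
rewrite -[in RHS]natr1 EFinD ge0_muleDl ?lee_fin//.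
by rewrite mul1e addeC.
Qed.

End design_expectation.

(** * Mean Frobenius norm of the kernel matrix of the design *)

Section kernel.
Context {R : realType} {d : nat} {I : countType} (phi : I -> regfun R d).
Notation pt := (Defs.point R d).
Notation U := (@unif R d).
Hypothesis hphi : orthonormal_basis phi.
Variables (J : seq I) (uJ : uniq J).

Lemma integral_comb_sqr (b : I -> R) :
  (\int[U]_t (comb phi J b t ^+ 2)%:E = (\sum_(l <- J) b l ^+ 2)%:E)%E.
Proof.
have ii l : U.-integrable [set: pt] (EFin \o (fun t => comb phi J b t * phi l t)).
  rewrite (_ : _ \o _ = fun t => (\sum_(m <- J) (b m)%:E *
    (EFin \o (fun t => phi m t * phi l t)%R) t)%E); last first.
    apply/funext => t /=; rewrite sumEFin mulr_suml; congr (_%:E).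
    by apply: eq_bigr => m _; rewrite mulrA.
  apply: integrable_sum => // m _; apply: integrableZl => //.
  exact: basis_mul_integrable.
transitivity (\int[U]_t (comb phi J b t ^+ 2))%:E.
  rewrite /Rintegral fineK// ge0_fin_numE.
    have [h _] := comb_L2_centered hphi J b.
    under eq_integral do rewrite -real_normK ?num_real//.
    exact: (@LqNorm_lty _ _ 2 _ isT h).
  by apply: integral_ge0 => t _; rewrite lee_fin sqr_ge0.
congr (_%:E).
have E t : comb phi J b t ^+ 2 = \sum_(l <- J) b l * (comb phi J b t * phi l t).
  by rewrite expr2 [in X in _ * X]/comb mulr_sumr; apply: eq_bigr => l _; rewrite mulrCA.
under eq_Rintegral do rewrite E.
rewrite (Rintegral_sum _ _ ii) big_seq [RHS]big_seq; apply: eq_bigr => l lJ.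
by have := coef_comb hphi b uJ l; rewrite /coef lJ => ->; rewrite expr2.
Qed.

(** The reproducing kernel of the span of the [phi l], for [l] in [J]. *)
Definition basis_kernel (t t' : pt) : R := \sum_(l <- J) phi l t * phi l t'.

(** Squared Frobenius norm of the kernel matrix of the design points. By [sum_sqr_gram] it is also
    that of the matrix of the sums over [i] of [phi k t_i * phi l t_i], indexed by [J], and this
    form is the one whose mean is computed by adding design points. *)
Definition gram n (t : n.-tuple pt) : R :=
  \sum_(i < n) \sum_(j < n) basis_kernel (tnth t i) (tnth t j) ^+ 2.

Lemma measurable_basis_kernel d' (T : measurableType d') (u v : T -> pt) :
  measurable_fun [set: T] u -> measurable_fun [set: T] v ->
  measurable_fun [set: T] (fun x => basis_kernel (u x) (v x)).
Proof.
move=> mu mv; apply: measurable_sum => l.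
by apply: measurable_funM; exact: measurableT_comp.
Qed.

Lemma measurable_gram n : measurable_fun [set: n.-tuple pt] (@gram n).
Proof.
apply: measurable_sum => i; apply: measurable_sum => j.
by apply: measurable_funX; apply: measurable_basis_kernel; exact: measurable_tnth.
Qed.

Lemma gram_ge0 n (t : n.-tuple pt) : 0 <= gram t.
Proof. by apply: sumr_ge0 => i _; apply: sumr_ge0 => j _; exact: sqr_ge0. Qed.

Lemma gram_cons n x (t : n.-tuple pt) : gram (Defs.cons_tuple (x, t)) =
  basis_kernel x x ^+ 2 + 2 * \sum_(j < n) basis_kernel x (tnth t j) ^+ 2 + gram t.
Proof.
have kC u v : basis_kernel u v = basis_kernel v u.
  by apply: eq_bigr => l _; rewrite mulrC.
have tS j : tnth (Defs.cons_tuple (x, t)) (lift ord0 j) = tnth t j by rewrite tnthS.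
have t0 : tnth (Defs.cons_tuple (x, t)) ord0 = x by [].
rewrite /gram big_ord_recl big_ord_recl t0.
under eq_bigr do rewrite tS.
under [X in _ + X = _]eq_bigr do rewrite big_ord_recl t0 tS kC.
rewrite big_split/=.
under [X in _ + (_ + X) = _]eq_bigr do under eq_bigr do rewrite tS.
ring.
Qed.

(** A new point [x] adds a diagonal term, at most [B ^+ 2], and twice [n] terms with mean the
    integral of [basis_kernel x t ^+ 2] over [t]. By Parseval this integral is the sum of the
    [phi l x ^+ 2], at most [B] again. *)
Lemma integral_gram (B : R) n : 0 <= B ->
  (forall t, cube t -> \sum_(l <- J) phi l t ^+ 2 <= B) ->
  (\int[iid_prob U n]_t (gram t)%:E <= (n%:R * B ^+ 2 + n%:R ^+ 2 * B)%:E)%E.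
Proof.
move=> B0 hB; elim: n => [|n IH].
  rewrite mul0r expr0n mul0r addr0.
  under eq_integral do rewrite /gram big_ord0.
  by rewrite integral0.
rewrite iid_integralS; last 2 first.
- by apply/measurable_EFinP; exact: measurable_gram.
- by move=> t; rewrite lee_fin gram_ge0.
pose C : R := n.+1%:R * B ^+ 2 + n.+1%:R ^+ 2 * B.
have C0 : 0 <= C by rewrite addr_ge0// mulr_ge0// exprn_ge0.
apply: (@le_trans _ _ (\int[U]_x C%:E)%E); last first.
  by rewrite integral_cst//= probability_setT mule1.
apply: le_integral_cube => //.
- apply: (@measurable_fun_fubini_tonelli_F _ _ _ _ _ (iid_prob U n)
    ((fun t => (gram t)%:E) \o @Defs.cons_tuple _ pt n)).
    apply: measurableT_comp; last exact: Defs.measurable_cons_tuple.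
    by apply/measurable_EFinP; exact: measurable_gram.
  by move=> x; rewrite /= lee_fin gram_ge0.
- by move=> x; apply: integral_ge0 => t _; rewrite lee_fin gram_ge0.
move=> x cx.
have mk : measurable_fun [set: pt] (fun t => basis_kernel x t ^+ 2).
  by apply: measurable_funX; exact: measurable_basis_kernel.
have ms : measurable_fun [set: n.-tuple pt]
    (fun t => \sum_(j < n) basis_kernel x (tnth t j) ^+ 2).
  apply: measurable_sum => j.
  by apply: (measurableT_comp mk); exact: measurable_tnth.
under eq_integral do rewrite gram_cons.
rewrite ge0_integral_EFinD; last 4 first.
- by apply: measurable_funD => //; exact: measurable_funM.
- exact: measurable_gram.
- by move=> t; rewrite addr_ge0 ?sqr_ge0// mulr_ge0// sumr_ge0// => j _; exact: sqr_ge0.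
- by move=> t; exact: gram_ge0.
rewrite ge0_integral_EFinD; last 4 first.
- by [].
- exact: measurable_funM.
- by move=> t; exact: sqr_ge0.
- by move=> t; rewrite mulr_ge0// sumr_ge0// => j _; exact: sqr_ge0.
rewrite (@ge0_integral_EFinZl _ _ _ _ 2)//; last first.
  by move=> t; rewrite sumr_ge0// => j _; exact: sqr_ge0.
rewrite (iid_integral_sum U n mk); last by move=> t; exact: sqr_ge0.
have -> : (\int[U]_t (basis_kernel x t ^+ 2)%:E = (\sum_(l <- J) phi l x ^+ 2)%:E)%E.
  exact: integral_comb_sqr (fun l => phi l x).
rewrite integral_cst//= probability_setT mule1.
have hk : basis_kernel x x <= B.
  by rewrite (le_trans _ (hB x cx))// /basis_kernel; apply: ler_sum => l _; rewrite expr2.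
have hk0 : 0 <= basis_kernel x x.
  by apply: sumr_ge0 => l _; rewrite -expr2 sqr_ge0.
have hs := hB x cx.
apply: (@le_trans _ _ ((B ^+ 2)%:E + 2%:E * (n%:R%:E * B%:E) +
    (n%:R * B ^+ 2 + n%:R ^+ 2 * B)%:E)%E).
  apply: leeD => //; apply: leeD; first by rewrite lee_fin lerXn2r// nnegrE.
  by rewrite -!EFinM lee_fin ler_wpM2l// ler_wpM2l.
rewrite -!EFinM -!EFinD lee_fin /C -natr1.
by have : 0 <= n%:R :> R by []; nra.
Qed.

End kernel.

(** * Second moment over pairs of sign vectors *)

Section signs_chi2.
Context {R : realType}.

Lemma signed_sum_sum n (s : seq R) (c : 'I_n -> R) (x : 'I_n -> nat -> R) :
  signed_sum s (fun k => \sum_(i < n) c i * x i k) =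
  \sum_(i < n) c i * signed_sum s (x i).
Proof.
rewrite /signed_sum; under eq_bigr do rewrite mulr_sumr.
rewrite exchange_big/=; apply: eq_bigr => i _.
by rewrite mulr_sumr; apply: eq_bigr => k _; rewrite mulrCA.
Qed.

(** With [X] the matrix of the [x i k], this is tr((X^T X)^2) = tr((X X^T)^2). *)
Lemma sum_sqr_gram n N (x : 'I_n -> nat -> R) :
  \sum_(l < N) \sum_(k < N) (\sum_(i < n) x i k * x i l) ^+ 2 =
  \sum_(i < n) \sum_(j < n) (\sum_(k < N) x i k * x j k) ^+ 2.
Proof.
transitivity (\sum_(l < N) \sum_(k < N) \sum_(i < n) \sum_(j < n)
    (x i k * x j k) * (x i l * x j l)).
  apply: eq_bigr => l _; apply: eq_bigr => k _.
  rewrite expr2 mulr_suml; apply: eq_bigr => i _.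
  by rewrite mulr_sumr; apply: eq_bigr => j _; rewrite mulrACA.
under eq_bigr do rewrite exchange_big; rewrite exchange_big/=.
apply: eq_bigr => i _.
under eq_bigr do rewrite exchange_big; rewrite exchange_big/=.
apply: eq_bigr => j _; rewrite expr2 mulr_sumr; apply: eq_bigr => l _.
by rewrite mulr_suml.
Qed.

(** For fixed [s] the exponent is linear in [s'], with coefficients [signed_sum s (B l)]. Summing
    over [s'] by [signs_expR] leaves the exponential of a sum of squares of signed sums in [s],
    which [signs_expR_quad] bounds. *)
Lemma signs_chi2 n N (a : R) (x : 'I_n -> nat -> R) :
  a ^+ 4 * (\sum_(i < n) \sum_(j < n) (\sum_(k < N) x i k * x j k) ^+ 2) <= 32^-1 ->
  \sum_(s <- signs N) \sum_(s' <- signs N)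
    expR (\sum_(i < n) (a * signed_sum s (x i)) * (a * signed_sum s' (x i))) <=
  expR (4 * (a ^+ 4 * \sum_(i < n) \sum_(j < n) (\sum_(k < N) x i k * x j k) ^+ 2)) *
  (2 ^+ N) ^+ 2.
Proof.
pose B l k := \sum_(i < n) (a ^+ 2 * x i l) * x i k.
pose rows := [seq B l | l <- index_iota 0 N].
have tauE : \sum_(r <- rows) \sum_(k < N) r k ^+ 2 =
    a ^+ 4 * \sum_(i < n) \sum_(j < n) (\sum_(k < N) x i k * x j k) ^+ 2.
  rewrite big_map big_mkord -sum_sqr_gram mulr_sumr; apply: eq_bigr => l _.
  rewrite mulr_sumr; apply: eq_bigr => k _.
  rewrite (_ : B l k = a ^+ 2 * \sum_(i < n) x i k * x i l); first by rewrite exprMn -exprM.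
  by rewrite /B mulr_sumr; apply: eq_bigr => i _; rewrite -mulrA [x i l * _]mulrC.
rewrite -tauE => tau; have := signs_expR_quad tau => H.
rewrite exprS expr1 mulrA [_ * 2 ^+ N]mulrC.
apply: (@le_trans _ _ (2 ^+ N *
    \sum_(s <- signs N) expR (2 * \sum_(r <- rows) signed_sum s r ^+ 2))).
  rewrite mulr_sumr; apply: ler_sum => s _.
  have E s' : \sum_(i < n) (a * signed_sum s (x i)) * (a * signed_sum s' (x i)) =
      signed_sum s' (fun l => signed_sum s (B l)).
    have -> : (fun l => signed_sum s (B l)) =
        (fun l => \sum_(i < n) (a ^+ 2 * signed_sum s (x i)) * x i l).
      apply/funext => l; rewrite /B signed_sum_sum; apply: eq_bigr => i _.
      by rewrite mulrAC.
    rewrite signed_sum_sum; apply: eq_bigr => i _; ring.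
  under eq_bigr do rewrite E.
  apply: (le_trans (signs_expR _ _)).
  by rewrite big_map big_mkord.
apply: ler_wpM2l; first exact: exprn_ge0.
by rewrite [leRHS]mulrC.
Qed.

Lemma signed_sum_index (I : eqType) (l0 : I) (J : seq I) (s : seq R) (u : I -> R) :
  uniq J -> size s = size J ->
  \sum_(l <- J) s`_(index l J) * u l = signed_sum s (fun k => u (nth l0 J k)).
Proof.
move=> uJ sJ; rewrite (big_nth l0) big_mkord /signed_sum sJ.
by apply: eq_bigr => k _; rewrite index_uniq.
Qed.

End signs_chi2.

(** * Positivity of the Gaussian quantile *)

Section gauss_quantile.
Context {R : realType}.
Notation gauss := (normal_prob (0 : R) 1).

Lemma gauss_itvNyo0 : gauss (`]-oo, 0[%classic : set R) = (1 / 2)%:E.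
Proof.
have m2 : measurable (`[0, +oo[%classic : set R) by exact: measurable_itv.
have h : gauss (`[0, +oo[%classic : set R) = (1 / 2)%:E.
  have := @ge0_symfun_integralT R (normal_pdf 0 1) (normal_pdf_ge0 _ _).
  rewrite integral_normal_pdf => /(_ _ _)/esym E.
  pose A : set R := `[0, +oo[%classic.
  have {}E : (2%:E * gauss A = 1)%E.
    rewrite /A set_itvcy; apply: E.
      by apply: continuous_normal_pdf; rewrite oner_neq0.
    move=> x /=; rewrite normal_pdfE ?oner_neq0// /normal_fun !subr0.
    by rewrite sqrrN.
  have f : gauss A \is a fin_num by exact: fin_num_measure.
  move: E; rewrite -/A -(fineK f) -EFinM => -[E]; congr (_%:E).
  by move: E; set x := fine _ => E; lra.
have E := probability_setC gauss m2; rewrite setCitvr in E; rewrite E.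
transitivity (1 - (1 / 2 : R)%:E)%E; first by congr (1 - _)%E; exact: h.
by rewrite -EFinB; congr (_%:E); field.
Qed.

(** The half-line below 0 has mass 1/2, and the density is bounded by its peak, so the mass cannot
    reach [alpha] before a positive abscissa. *)
Lemma gauss_quantile_gt0 (alpha : R) : 1 / 2 < alpha < 1 -> 0 < gauss_quantile alpha.
Proof.
move=> /andP[a1 a2].
pose p : R := normal_peak 1.
have p0 : 0 < p by apply: normal_peak_gt0; rewrite oner_neq0.
(* With this [eta] the interval [[0, eta]] has mass at most [(alpha - 1 / 2) / 2], half of what is
   missing at 0. *)
pose eta : R := (alpha - 1 / 2) / (2 * p).
have eta0 : 0 < eta by rewrite divr_gt0 ?subr_gt0// mulr_gt0.
apply: (lt_le_trans eta0); apply: lb_le_inf.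
  (* Nonemptiness is needed to bound [inf] from below: were the set empty, the distribution function
     would stay below [alpha < 1], against its limit 1. *)
  apply/set0P/negP => /eqP E.
  pose mix := @isMeasurableFun.Build _ _ (measurableTypeR R) R
    (idfun : measurableTypeR R -> R) (@measurable_id _ _ _).
  pose X : {mfun measurableTypeR R >-> R} := HB.pack (idfun : measurableTypeR R -> R) mix.
  have c1 := @cvg_cdfy1 _ _ _ gauss X.
  have : (lim (cdf (P := gauss) X r @[r --> +oo%R]) <= alpha%:E)%E.
    apply: lime_le; first by apply/cvg_ex; exists 1%E.
    apply: nearW => r; apply/ltW; rewrite ltNge; apply/negP => h.
    by have : [set x | (alpha%:E <= gauss `]-oo, x])%E] r by []; rewrite E.
  by rewrite (cvg_lim _ c1)// lee_fin leNgt a2.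
move=> x /= hx; rewrite leNgt; apply/negP => xeta.
pose A : set R := `]-oo, 0[%classic; pose B : set R := `[0, eta]%classic.
have mA : measurable A by exact: measurable_itv.
have mB : measurable B by exact: measurable_itv.
have h1 : (gauss `]-oo, x] <= gauss (A `|` B))%E.
  apply: le_measure; rewrite ?inE; [exact: measurable_itv|exact: measurableU|].
  move=> y; rewrite /A /B /= !in_itv/= => yx.
  by have [y0|y0] := ltP y 0; [left|right; lra].
have h2 : (gauss (A `|` B) <= gauss A + gauss B)%E by exact: measureU2.
have h3 : (gauss B <= (p * eta)%:E)%E.
  apply: (@le_trans _ _ (\int[lebesgue_measure]_(x in B) p%:E)%E).
    apply: ge0_le_integral => //.
    - by move=> y _; rewrite lee_fin normal_pdf_ge0.
    - by apply/measurable_EFinP/measurable_funTS; exact: measurable_normal_pdf.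
    - by move=> y _; rewrite lee_fin; apply: normal_pdf_ub; rewrite oner_neq0.
  by rewrite integral_cst//= lebesgue_measure_itv/= lte_fin eta0 -EFinD subr0 EFinM.
have := le_trans hx (le_trans h1 (le_trans h2 (leeD (lexx _) h3))).
rewrite gauss_itvNyo0 -EFinD lee_fin.
have -> : p * eta = (alpha - 1 / 2) / 2 by rewrite /eta; field; rewrite gt_eqF.
by lra.
Qed.

End gauss_quantile.

Lemma le_limn_einf (R : realType) (u : nat -> \bar R) (g : \bar R) :
  (\forall n \near \oo, (g <= u n)%E) -> (g <= limn_einf u)%E.
Proof.
move=> [N _ hN]; rewrite limn_einf_lim; apply: lime_ge; first exact: is_cvg_einfs.
exists N => // n /= Nn; apply: le_ereal_inf_tmp => _ [k /= nk <-].
by apply: hN => /=; exact: leq_trans nk.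
Qed.

Lemma sum_fine_le (R : realType) (J : eqType) (S : seq J) (X : J -> \bar R) (C : R) :
  (forall s, 0 <= X s)%E -> (\sum_(s <- S) X s <= C%:E)%E ->
  (forall s, s \in S -> X s \is a fin_num) /\ \sum_(s <- S) fine (X s) <= C.
Proof.
move=> X0 XC; have fin s : s \in S -> X s \is a fin_num.
  move=> sS; rewrite ge0_fin_numE//; apply: le_lt_trans (ltry C).
  apply: le_trans XC; rewrite (big_rem s)//= leeDl//.
  by apply: sume_ge0.
split=> //; rewrite -lee_fin -sumEFin; apply: le_trans XC.
rewrite big_seq [leRHS]big_seq; apply: lee_sum => s sS.
by rewrite fineK ?fin.
Qed.

(** * The random sign prior and the two-point prior *)

Section sign_prior.
Context {R : realType} {d : nat} {I : countType} (phi : I -> regfun R d).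
Notation pt := (Defs.point R d).
Notation U := (@unif R d).
(** [a] is the amplitude of the signs, [m] bounds the |q_l|, and [B] bounds the diagonal of the
    kernel. [tau] is the threshold for [a ^+ 4 * gram], [v] bounds the mean of this quantity, and
    [e] bounds the share of draws violating a norm constraint. *)
Variables (c q : I -> R) (L T : R) (n : nat) (J : seq I) (a m B rho v e tau : R).
Hypotheses (hphi : orthonormal_basis phi) (c0 : forall l, 0 <= c l) (L0 : 0 < L).
Hypotheses (uJ : uniq J) (J0 : (0 < size J)%N).
Hypotheses (JT : forall l, l \in J -> NT c q T l).
Hypothesis sgn : (forall l, l \in J -> 0 < q l) \/ (forall l, l \in J -> q l < 0).
Hypotheses (m0 : 0 < m) (qm : forall l, l \in J -> `|q l| <= m).
Hypotheses (a0 : 0 < a) (B0 : 0 <= B).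
Hypothesis hB : forall t, cube t -> \sum_(l <- J) phi l t ^+ 2 <= B.
Hypotheses (tau0 : 0 < tau) (tau1 : tau <= 32^-1).
Hypothesis hc : \sum_(l <- J) c l * a ^+ 2 <= 1.
Hypothesis hrho : rho ^+ 2 <= a ^+ 2 * \sum_(l <- J) `|q l|.
Hypothesis hv : a ^+ 4 * (n%:R * B ^+ 2 + n%:R ^+ 2 * B) <= v.
Hypothesis he : 3 * a ^+ 4 * B ^+ 2 / L ^+ 4 + 3 * a ^+ 4 * m ^+ 2 * B ^+ 2 / L ^+ 2 <= e.

Let N := size J.
Let b (s : seq R) (l : I) : R := a * s`_(index l J).
Let f (s : seq R) : regfun R d := comb phi J (b s).
(** The zero function, as an empty combination, so that [Sigma_comb] and [Q_comb] cover it. *)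
Let f0 : regfun R d := comb phi [::] (fun=> 0).

Let comb_nil t : f0 t = 0.
Proof. by rewrite /f0/= /comb big_nil. Qed.

Let sizeS : (size (signs N : seq (seq R)))%:R = 2 ^+ N :> R.
Proof. by rewrite size_signs natrX. Qed.

Let combE l0 s t : size s = N ->
  comb phi J (b s) t = a * signed_sum s (fun k => phi (nth l0 J k) t).
Proof.
move=> sN; rewrite /comb /b; under eq_bigr do rewrite -mulrA.
by rewrite -mulr_sumr (signed_sum_index l0 (fun l => phi l t)).
Qed.

Let TQE l0 s t : size s = N -> TQ phi c q T (comb phi J (b s)) t =
  a * signed_sum s (fun k => q (nth l0 J k) * phi (nth l0 J k) t).
Proof.
move=> sN; rewrite TQ_comb//.
rewrite -(signed_sum_index l0 (fun l => q l * phi l t))// mulr_sumr.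
rewrite big_seq [RHS]big_seq; apply: eq_bigr => l lJ.
by rewrite mem_set; [rewrite /b; ring|exact: JT].
Qed.

Let bsqr s l : s \in signs N -> l \in J -> b s l ^+ 2 = a ^+ 2.
Proof.
move=> /mem_signs[_ h] lJ; rewrite /b exprMn h ?mulr1//.
by rewrite index_mem.
Qed.

Let sum_nth l0 (F : I -> R) : \sum_(l <- J) F l = \sum_(k < N) F (nth l0 J k).
Proof. by rewrite (big_nth l0) big_mkord. Qed.

Let chi2 (l0 : I) (t : n.-tuple pt) : a ^+ 4 * gram phi J t <= tau ->
  \sum_(s <- signs N) \sum_(s' <- signs N)
    expR (\sum_(i < n) comb phi J (b s) (tnth t i) * comb phi J (b s') (tnth t i))
  <= (1 + (expR (4 * tau) - 1)) * (size (signs N : seq (seq R)))%:R ^+ 2.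
Proof.
move=> ht; pose x (i : 'I_n) k := phi (nth l0 J k) (tnth t i).
have gE : gram phi J t =
    \sum_(i < n) \sum_(j < n) (\sum_(k < N) x i k * x j k) ^+ 2.
  apply: eq_bigr => i _; apply: eq_bigr => j _; congr (_ ^+ 2).
  by rewrite /basis_kernel (sum_nth l0).
have -> : \sum_(s <- signs N) \sum_(s' <- signs N)
    expR (\sum_(i < n) comb phi J (b s) (tnth t i) * comb phi J (b s') (tnth t i)) =
    \sum_(s <- signs N) \sum_(s' <- signs N)
    expR (\sum_(i < n) (a * signed_sum s (x i)) * (a * signed_sum s' (x i))).
  rewrite big_seq [RHS]big_seq; apply: eq_bigr => s /mem_signs[sN _].
  rewrite big_seq [RHS]big_seq; apply: eq_bigr => s' /mem_signs[s'N _].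
  by congr expR; apply: eq_bigr => i _; rewrite !(combE l0).
apply: (le_trans (signs_chi2 _)); first by rewrite -gE (le_trans ht).
rewrite sizeS addrC subrK ler_wpM2r ?exprn_ge0//.
by rewrite ler_expR ler_pM2l// -gE.
Qed.

Let X4 s := (\int[U]_t (comb phi J (b s) t ^+ 4)%:E)%E.
Let X2 s := (\int[U]_t ((comb phi J (b s) t * TQ phi c q T (comb phi J (b s)) t) ^+ 2)%:E)%E.

Let X40 s : (0 <= X4 s)%E.
Proof. by apply: integral_ge0 => t _; rewrite lee_fin exprn_even_ge0. Qed.

Let X20 s : (0 <= X2 s)%E.
Proof. by apply: integral_ge0 => t _; rewrite lee_fin sqr_ge0. Qed.

(** Summing over the signs before integrating lets the moment inequalities for signs be used at each
    fixed point of the cube. *)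
Let sumX (g : seq R -> pt -> R) (C : R) : 0 <= C ->
  (forall s, measurable_fun [set: pt] (g s)) -> (forall s t, 0 <= g s t) ->
  (forall t, cube t -> \sum_(s <- signs N) g s t <= C) ->
  (\sum_(s <- signs N) \int[U]_t (g s t)%:E <= C%:E)%E.
Proof.
move=> C0 mg g0 gC; rewrite -ge0_integral_EFin_sum//.
apply: (@le_trans _ _ (\int[U]_t C%:E)%E); last first.
  by rewrite integral_cst//= probability_setT mule1.
apply: le_integral_cube => //.
- by apply/measurable_EFinP; exact: measurable_sum.
- by move=> t; rewrite lee_fin sumr_ge0.
Qed.

Let pow4_le (u : I -> R) (l0 : I) t (C : R) : (forall l, l \in J -> `|u l| <= C) ->
  0 <= C -> cube t ->
  \sum_(s <- signs N) signed_sum s (fun k => u (nth l0 J k) * phi (nth l0 J k) t) ^+ 4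
  <= 2 ^+ N * (3 * C ^+ 4 * B ^+ 2).
Proof.
move=> uC C0 ct; apply: (le_trans (signs_pow4 _ _)).
rewrite ler_wpM2l ?exprn_ge0// -mulrA ler_pM2l//.
rewrite -(sum_nth l0 (fun l => (u l * phi l t) ^+ 2)).
rewrite (_ : C ^+ 4 * B ^+ 2 = (C ^+ 2 * B) ^+ 2); last by ring.
rewrite lerXn2r ?nnegrE ?mulr_ge0 ?exprn_ge0//.
  by apply: sumr_ge0 => l _; exact: sqr_ge0.
apply: (@le_trans _ _ (C ^+ 2 * \sum_(l <- J) phi l t ^+ 2)).
  rewrite mulr_sumr big_seq [leRHS]big_seq; apply: ler_sum => l lJ.
  rewrite exprMn ler_wpM2r ?sqr_ge0// -(real_normK (num_real (u l))).
  by rewrite lerXn2r ?nnegrE ?uC.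
by rewrite ler_wpM2l ?exprn_ge0// hB.
Qed.

Let sumX4 (l0 : I) : (\sum_(s <- signs N) X4 s <= (2 ^+ N * (3 * a ^+ 4 * B ^+ 2))%:E)%E.
Proof.
apply: sumX.
- by rewrite !mulr_ge0 ?exprn_ge0// ltW.
- by move=> s; apply: measurable_funX; exact: measurable_comb.
- by move=> s t; rewrite exprn_even_ge0.
move=> t ct; have := @pow4_le (fun=> 1) l0 t 1 _ ler01 ct.
rewrite normr1 => /(_ (fun _ _ => lexx _)) h.
rewrite (eq_big_seq (fun s => a ^+ 4 *
    signed_sum s (fun k => 1 * phi (nth l0 J k) t) ^+ 4)); last first.
  move=> s /mem_signs[sN _]; rewrite (combE l0)// exprMn.
  by under [in RHS]eq_fun do rewrite mul1r.
rewrite -mulr_sumr; apply: (le_trans (ler_wpM2l (exprn_ge0 4 (ltW a0)) h)).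
by rewrite expr1n [leLHS](_ : _ = 2 ^+ N * (3 * a ^+ 4 * B ^+ 2))//; ring.
Qed.

Let sumX2 (l0 : I) :
  (\sum_(s <- signs N) X2 s <= (2 ^+ N * (3 * a ^+ 4 * m ^+ 2 * B ^+ 2))%:E)%E.
Proof.
apply: sumX.
- by rewrite !mulr_ge0 ?exprn_ge0// ltW.
- move=> s; apply: measurable_funX; apply: measurable_funM.
    exact: measurable_comb.
  exact: measurable_TQ_comb.
- by move=> s t; rewrite sqr_ge0.
move=> t ct; have := @pow4_le (fun=> 1) l0 t 1 _ ler01 ct.
rewrite normr1 => /(_ (fun _ _ => lexx _)) h1.
have h2 := @pow4_le q l0 t m qm (ltW m0) ct.
pose A1 s : R := signed_sum s (fun k => 1 * phi (nth l0 J k) t).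
pose A2 s : R := signed_sum s (fun k => q (nth l0 J k) * phi (nth l0 J k) t).
(* AM-GM: [2 x^2 y^2 <= m^2 x^4 + y^4 / m^2] *)
apply: (@le_trans _ _ (\sum_(s <- signs N) (a ^+ 4 / 2) *
    (m ^+ 2 * A1 s ^+ 4 + m ^- 2 * A2 s ^+ 4))).
  rewrite big_seq [leRHS]big_seq; apply: ler_sum => s /mem_signs[sN _].
  rewrite (combE l0)// (TQE l0)//.
  have -> : signed_sum s (fun k => phi (nth l0 J k) t) = A1 s.
    by rewrite /A1; under [in RHS]eq_fun do rewrite mul1r.
  rewrite -/(A2 s) -subr_ge0.
  rewrite (_ : _ - _ = a ^+ 4 / 2 * (m * A1 s ^+ 2 - m^-1 * A2 s ^+ 2) ^+ 2).
    by rewrite mulr_ge0 ?sqr_ge0// divr_ge0 ?exprn_ge0// ltW.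
  by field; rewrite gt_eqF.
rewrite -mulr_sumr big_split/= -!mulr_sumr.
have m2 : 0 < m ^+ 2 by rewrite exprn_gt0.
have H1 : m ^+ 2 * \sum_(s <- signs N) A1 s ^+ 4 <=
    m ^+ 2 * (2 ^+ N * (3 * 1 ^+ 4 * B ^+ 2)) by rewrite ler_pM2l.
have H2 : m ^- 2 * \sum_(s <- signs N) A2 s ^+ 4 <=
    m ^- 2 * (2 ^+ N * (3 * m ^+ 4 * B ^+ 2)) by rewrite ler_pM2l// invr_gt0.
have H3 : m ^- 2 * (2 ^+ N * (3 * m ^+ 4 * B ^+ 2)) = m ^+ 2 * (2 ^+ N * (3 * B ^+ 2)).
  by field; rewrite gt_eqF.
apply: (@le_trans _ _ (a ^+ 4 / 2 * (m ^+ 2 * (2 ^+ N * (3 * 1 ^+ 4 * B ^+ 2)) +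
    m ^+ 2 * (2 ^+ N * (3 * B ^+ 2))))).
  apply: ler_wpM2l; first by rewrite divr_ge0// exprn_ge0// ltW.
  by rewrite -H3 lerD.
rewrite expr1n [leLHS](_ : _ = 2 ^+ N * (3 * a ^+ 4 * m ^+ 2 * B ^+ 2))//.
by field.
Qed.

Lemma sign_prior_minimax_risk :
  1 - (Num.sqrt (expR (4 * tau) - 1) + v / tau) - e <=
  minimax_risk n (F0 phi c q L T) (F1 phi c q L T rho).
Proof.
have [l0 l0J] : exists l0, l0 \in J by case: J J0 => // l J' _; exists l; rewrite mem_head.
have [fin4 le4] := sum_fine_le X40 (sumX4 l0).
have [fin2 le2] := sum_fine_le X20 (sumX2 l0).
have N0 : 0 < 2 ^+ N :> R by rewrite exprn_gt0.
(* [w s < 1] forces both norm constraints, and the averaged fourth moment bounds control the mean of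
   [w]. *)
pose w s := fine (X4 s) / L ^+ 4 + fine (X2 s) / L ^+ 2.
have L4 : 0 < L ^+ 4 by rewrite exprn_gt0.
have L2 : 0 < L ^+ 2 by rewrite exprn_gt0.
have w4 s : 0 <= fine (X4 s) / L ^+ 4 by rewrite divr_ge0 ?fine_ge0// ltW.
have w2 s : 0 <= fine (X2 s) / L ^+ 2 by rewrite divr_ge0 ?fine_ge0// ltW.
apply: (@minimax_risk_ge _ _ _ _ _ _ f0 (signs N) f w).
- split; last by rewrite Q_comb// big_nil.
  apply: Sigma_comb => //; first exact: ltW.
  + by rewrite big_nil.
  + rewrite integral0_eq ?lee_fin 1?ltW// => t _.
    by rewrite comb_nil expr0n.
  + rewrite integral0_eq ?lee_fin 1?ltW// => t _.
    by rewrite comb_nil mul0r expr0n.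
- by rewrite size_signs expn_gt0.
- by move=> s; rewrite addr_ge0.
- move=> s sS; have [|w1] := leP 1 (w s); [by right|left].
  split.
    apply: Sigma_comb => //; first exact: ltW.
    + rewrite big_seq; under eq_bigr do rewrite bsqr//.
      by rewrite -big_seq.
    + have E4 : X4 s = (fine (X4 s))%:E by rewrite fineK// fin4.
      apply: (@le_trans _ _ (X4 s)) => //; rewrite E4 lee_fin.
      by rewrite -[leRHS]mul1r -ler_pdivrMr//; move: w1 (w2 s); rewrite /w; lra.
    + have E2 : X2 s = (fine (X2 s))%:E by rewrite fineK// fin2.
      apply: (@le_trans _ _ (X2 s)) => //; rewrite E2 lee_fin.
      by rewrite -[leRHS]mul1r -ler_pdivrMr//; move: w1 (w4 s); rewrite /w; lra.
  rewrite Q_comb// (_ : \sum_(l <- J) _ = a ^+ 2 * \sum_(l <- J) q l); last first.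
    rewrite mulr_sumr big_seq [RHS]big_seq; apply: eq_bigr => l lJ.
    by rewrite bsqr// mulrC.
  rewrite normrM [X in X * _]ger0_norm ?sqr_ge0// (le_trans hrho)//.
  rewrite ler_pM2l ?exprn_gt0//; case: sgn => h.
    rewrite big_seq (eq_bigr q) -?big_seq ?ler_norm// => l lJ.
    by rewrite gtr0_norm ?h.
  rewrite -normrN -sumrN big_seq (eq_bigr (fun l => - q l)) -?big_seq ?ler_norm// => l lJ.
  by rewrite ltr0_norm ?h.
- rewrite sizeS /w big_split/= -!mulr_suml; apply: le_trans he.
  rewrite ler_pdivrMl// mulrDr !mulrA lerD//; rewrite ler_pM2r ?invr_gt0//.
    by rewrite (le_trans le4)// !mulrA.
  by rewrite (le_trans le2)// !mulrA.
- move=> A mA; rewrite addrA.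
  apply: (@avg_test_power_le _ _ _ n f0 (signs N) f f
    (fun t => a ^+ 4 * gram phi J t) tau v (expR (4 * tau) - 1)) => //.
  + by rewrite size_signs expn_gt0.
  + by move=> s t; rewrite comb_nil add0r.
  + by apply: measurable_funM => //; exact: measurable_gram.
  + by move=> t; rewrite mulr_ge0 ?gram_ge0// exprn_ge0 1?ltW.
  + by rewrite subr_gt0 expR_gt1 mulr_gt0.
  + rewrite ge0_integral_EFinZl//; last 3 first.
    - exact: measurable_gram.
    - by move=> t; exact: gram_ge0.
    - by rewrite exprn_ge0// ltW.
    apply: (@le_trans _ _ ((a ^+ 4)%:E * (n%:R * B ^+ 2 + n%:R ^+ 2 * B)%:E)%E).
      by rewrite lee_pmul2l ?lte_fin ?exprn_gt0//; exact: integral_gram.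
    by rewrite -EFinM lee_fin.
  + exact: chi2.
Qed.

End sign_prior.

(** * The two-point lower bound *)

Section two_point.
Context {R : realType} {d : nat} {I : countType} (phi : I -> regfun R d).
Notation pt := (Defs.point R d).
Notation U := (@unif R d).
Variables (c q : I -> R) (L : R) (lp ln : I).
Hypotheses (hphi : orthonormal_basis phi) (c0 : forall l, 0 <= c l) (L0 : 0 < L).
Hypotheses (qp : 0 < q lp) (qn : q ln < 0).
Hypotheses (phip : (LqNorm 4 (phi lp) < +oo)%E) (phin : (LqNorm 4 (phi ln) < +oo)%E).

Let A : R := fine (\int[U]_t (`|phi lp t| ^+ 4)%:E) +
  fine (\int[U]_t (`|phi ln t| ^+ 4)%:E).
Let qm : R := `|q lp| + `|q ln|.
Let pair (x y : R) (l : I) : R := if l == lp then x else y.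

Let lnp : ln == lp = false.
Proof. by apply/negP => /eqP E; have := lt_trans qn qp; rewrite E ltxx. Qed.

Let uJ : uniq [:: lp; ln].
Proof. by rewrite /= inE eq_sym lnp. Qed.

Let pairE x y t : comb phi [:: lp; ln] (pair x y) t = x * phi lp t + y * phi ln t.
Proof. by rewrite /comb !big_cons big_nil /pair eqxx lnp addr0. Qed.

Let m4 l : measurable_fun [set: pt] (fun t => `|phi l t| ^+ 4).
Proof. by apply: measurable_funX; exact: measurableT_comp. Qed.

Let int_pow4 (C : R) : 0 <= C ->
  (\int[U]_t (C * (`|phi lp t| ^+ 4 + `|phi ln t| ^+ 4))%:E = (C * A)%:E)%E.
Proof.
move=> C0; rewrite ge0_integral_EFinZl//; last exact: measurable_funD.
rewrite ge0_integral_EFinD//.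
have fin l : (LqNorm 4 (phi l) < +oo)%E ->
    (\int[U]_t (`|phi l t| ^+ 4)%:E)%E \is a fin_num.
  move=> h; rewrite ge0_fin_numE; first exact: (@LqNorm_lty _ _ 4 _ isT h).
  by apply: integral_ge0 => t _; rewrite lee_fin exprn_ge0.
by rewrite EFinM /A EFinD !fineK ?fin.
Qed.

Let pow4_add_le (u v : R) : (u + v) ^+ 4 <= 8 * (u ^+ 4 + v ^+ 4).
Proof.
rewrite -subr_ge0 (_ : _ - _ = 4 * (u ^+ 2 - v ^+ 2) ^+ 2 +
  (u - v) ^+ 2 * ((u + v) ^+ 2 + 2 * u ^+ 2 + 2 * v ^+ 2)); last by ring.
apply: addr_ge0; first by rewrite mulr_ge0 ?sqr_ge0.
apply: mulr_ge0; first exact: sqr_ge0.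
by have := sqr_ge0 (u + v); have := sqr_ge0 u; have := sqr_ge0 v; lra.
Qed.

Let lin_le (x y B u v : R) : `|x| <= B -> `|y| <= B ->
  `|x * u + y * v| <= B * (`|u| + `|v|).
Proof.
move=> xB yB; rewrite (le_trans (ler_normD _ _))// !normrM mulrDr.
by rewrite lerD// ler_wpM2r.
Qed.

(** Uniform in [T]: whichever of the two indices the truncation keeps, the weights in [TQ] are at
    most [qm]. One bound [B] therefore serves along an arbitrary sequence of truncation levels. *)
Let pair_Sigma T (B x y : R) : 0 <= B -> `|x| <= B -> `|y| <= B ->
  (c lp + c ln) * B ^+ 2 <= 1 -> 8 * B ^+ 4 * A <= L ^+ 4 ->
  8 * (B ^+ 4 * qm ^+ 2) * A <= L ^+ 2 ->
  Sigma phi c q L T (comb phi [:: lp; ln] (pair x y)).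
Proof.
move=> B0 xB yB h1 h2 h3; apply: Sigma_comb => //; first exact: ltW.
- rewrite !big_cons big_nil /pair eqxx lnp addr0 (le_trans _ h1)// mulrDl.
  rewrite -(real_normK (num_real x)) -(real_normK (num_real y)).
  by rewrite lerD// ler_wpM2l// lerXn2r// nnegrE.
- apply: (@le_trans _ _ (8 * B ^+ 4 * A)%:E); last by rewrite lee_fin.
  rewrite -int_pow4; last by rewrite mulr_ge0// exprn_ge0.
  apply: ge0_le_integral_EFin.
  + by apply: measurable_funX; exact: measurable_comb.
  + by apply: measurable_funM => //; exact: measurable_funD.
  + by move=> t; rewrite exprn_even_ge0.
  move=> t; rewrite pairE -[leLHS]ger0_norm ?exprn_even_ge0// normrX.
  apply: (@le_trans _ _ ((B * (`|phi lp t| + `|phi ln t|)) ^+ 4)).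
    by rewrite lerXn2r ?nnegrE// ?lin_le// mulr_ge0// addr_ge0.
  rewrite exprMn [leRHS](_ : _ = B ^+ 4 *
    (8 * (`|phi lp t| ^+ 4 + `|phi ln t| ^+ 4))); last by ring.
  by apply: ler_wpM2l; [exact: exprn_ge0|exact: pow4_add_le].
- apply: (@le_trans _ _ (8 * (B ^+ 4 * qm ^+ 2) * A)%:E); last by rewrite lee_fin.
  have BC0 : 0 <= B ^+ 4 * qm ^+ 2 by rewrite mulr_ge0 ?sqr_ge0 ?exprn_ge0.
  rewrite -int_pow4; last by rewrite mulr_ge0.
  apply: ge0_le_integral_EFin.
  + apply: measurable_funX; apply: measurable_funM; first exact: measurable_comb.
    exact: measurable_TQ_comb.
  + by apply: measurable_funM => //; exact: measurable_funD.
  + by move=> t; rewrite sqr_ge0.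
  move=> t; rewrite TQ_comb// !big_cons big_nil addr0 pairE /pair eqxx lnp.
  set wp := if lp \in _ then _ else _; set wn := if ln \in _ then _ else _.
  have wpq : `|wp| <= qm by rewrite /wp /qm; case: ifP; rewrite ?normr0 ?lerDl ?addr_ge0.
  have wnq : `|wn| <= qm by rewrite /wn /qm; case: ifP; rewrite ?normr0 ?lerDr ?addr_ge0.
  have qm0 : 0 <= qm by rewrite addr_ge0.
  set w := `|phi lp t| + `|phi ln t|.
  have w0 : 0 <= w by rewrite addr_ge0.
  rewrite -(real_normK (num_real (_ * _))) normrM.
  apply: (@le_trans _ _ ((B * w * (qm * B * w)) ^+ 2)).
    rewrite lerXn2r ?nnegrE ?mulr_ge0//.
    rewrite ler_pM//; first exact: lin_le.
    by apply: lin_le; rewrite normrM ler_pM.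
  rewrite [leLHS](_ : _ = B ^+ 4 * qm ^+ 2 * w ^+ 4); last by ring.
  rewrite [leRHS](_ : _ = B ^+ 4 * qm ^+ 2 *
    (8 * (`|phi lp t| ^+ 4 + `|phi ln t| ^+ 4))); last by ring.
  by apply: ler_wpM2l => //; exact: pow4_add_le.
Qed.

Let Q_pair x y : Q phi q (comb phi [:: lp; ln] (pair x y)) =
  q lp * x ^+ 2 + q ln * y ^+ 2.
Proof. by rewrite Q_comb// !big_cons big_nil /pair eqxx lnp addr0. Qed.

(* [f0] has [Q f0 = 0] but a nonzero linear term of [Q] at [f0], so that moving
   the [lp]-coefficient by [n^(-1/2)] changes [Q] by the same order. *)
Lemma two_point_minimax_risk : exists C : R, 0 < C /\
  forall n (T : R), (0 < n)%N -> 3 / 8 <=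
    minimax_risk n (F0 phi c q L T) (F1 phi c q L T (C * n%:R `^ (- 4^-1))).
Proof.
have A0 : 0 <= A by rewrite addr_ge0// fine_ge0// integral_ge0// => t _;
  rewrite lee_fin exprn_ge0.
have L4 : 0 < L ^+ 4 by rewrite exprn_gt0.
have L2 : 0 < L ^+ 2 by rewrite exprn_gt0.
(* One summand per constraint of [pair_Sigma], each to be multiplied by at most [B = K^-1]; the
   summand 4 makes [del = B / 2] at most 1/8. *)
pose K : R := 4 + (c lp + c ln) + 8 * A / L ^+ 4 + 8 * qm ^+ 2 * A / L ^+ 2.
have k1 : 0 <= c lp + c ln by rewrite addr_ge0.
have k2 : 0 <= 8 * A / L ^+ 4 by rewrite !mulr_ge0 ?invr_ge0// ltW.
have k3 : 0 <= 8 * qm ^+ 2 * A / L ^+ 2.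
  apply: divr_ge0; last exact: ltW.
  by rewrite mulr_ge0// mulr_ge0// sqr_ge0.
have K4 : 4 <= K by rewrite /K; lra.
have K0 : 0 < K by rewrite (lt_le_trans _ K4).
pose B : R := K^-1.
have B0 : 0 < B by rewrite invr_gt0.
have BK : B * K = 1 by rewrite mulVf ?gt_eqF.
have B4 : B <= 4^-1 by rewrite lef_pV2// posrE.
have B2B : B ^+ 2 <= B by rewrite expr2 ler_piMr ?ltW//; lra.
have B4B : B ^+ 4 <= B.
  by rewrite (_ : B ^+ 4 = (B ^+ 2) ^+ 2); [nra|ring].
have small x : 0 <= x -> x <= K -> B * x <= 1.
  by move=> x0 xK; rewrite -BK ler_pM2l.
have h1 : (c lp + c ln) * B ^+ 2 <= 1.
  rewrite mulrC (le_trans _ (small _ k1 _))//; first by rewrite ler_wpM2r.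
  by rewrite /K; lra.
have h2 : 8 * B ^+ 4 * A <= L ^+ 4.
  rewrite -[leRHS]mul1r -ler_pdivrMr// [leLHS](_ : _ = B ^+ 4 * (8 * A / L ^+ 4)).
    rewrite (le_trans _ (small _ k2 _))//; first by rewrite ler_wpM2r.
    by rewrite /K; lra.
  by field; rewrite gt_eqF.
have h3 : 8 * (B ^+ 4 * qm ^+ 2) * A <= L ^+ 2.
  rewrite -[leRHS]mul1r -ler_pdivrMr// [leLHS](_ : _ = B ^+ 4 * (8 * qm ^+ 2 * A / L ^+ 2)).
    rewrite (le_trans _ (small _ k3 _))//; first by rewrite ler_wpM2r.
    by rewrite /K; lra.
  by field; rewrite gt_eqF.
(* The direction [(sp, sn)] is isotropic for the form [q lp * x ^+ 2 + q ln * y ^+ 2]. The factor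
   [eps] gives [x + y = B / 2], which leaves [B / 2] for the perturbation of [x]. *)
pose sp : R := Num.sqrt (- q ln); pose sn : R := Num.sqrt (q lp).
have sp0 : 0 < sp by rewrite sqrtr_gt0 oppr_gt0.
have sn0 : 0 < sn by rewrite sqrtr_gt0.
pose eps : R := B / 2 / (sp + sn).
have spn0 : 0 < sp + sn by rewrite addr_gt0.
have eps0 : 0 < eps by rewrite !divr_gt0.
have epsE : eps * sp + eps * sn = B / 2 by rewrite -mulrDr /eps divfK// gt_eqF.
pose x : R := eps * sp; pose y : R := eps * sn; pose del : R := B / 2.
have x0 : 0 < x by rewrite mulr_gt0.
have y0 : 0 < y by rewrite mulr_gt0.
have del0 : 0 < del by rewrite divr_gt0.
have xdel : x <= del by rewrite /x /del -epsE lerDl ltW// -/y.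
have ydel : y <= del by rewrite /y /del -epsE lerDr ltW// -/x.
have Q0 : q lp * x ^+ 2 + q ln * y ^+ 2 = 0.
  rewrite /x /y !exprMn !sqr_sqrtr ?oppr_ge0 ?ltW//; ring.
have C20 : 0 < 2 * q lp * x * del.
  by rewrite mulr_gt0// mulr_gt0// mulr_gt0.
(* The square of this constant is the coefficient of [r ^+ 2 = n^(-1/2)] in [Q f1]; the remaining
   term is nonnegative because [q lp > 0]. *)
exists (Num.sqrt (2 * q lp * x * del)); split; first by rewrite sqrtr_gt0.
move=> n T n0; pose r : R := n%:R `^ (- 4^-1).
have nR0 : 0 < n%:R :> R by rewrite ltr0n.
have r0 : 0 < r by rewrite powR_gt0.
have r4 : n%:R * r ^+ 4 = 1.
  rewrite -powR_mulrn ?ltW// /r -powRrM mulNr mulVf// powRN powRr1 ?ltW//.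
  by rewrite divff// gt_eqF.
have r1 : r ^+ 2 <= 1.
  have : r ^+ 4 <= 1.
    have n1 : 1 <= n%:R :> R by rewrite ler1n.
    by have := ler_peMl (exprn_ge0 4 (ltW r0)) n1; rewrite r4.
  rewrite (_ : r ^+ 4 = (r ^+ 2) ^+ 2); last by ring.
  by rewrite expr_le1// sqr_ge0.
have r20 : 0 < r ^+ 2 by rewrite exprn_gt0.
pose f0 : regfun R d := comb phi [:: lp; ln] (pair x y).
pose f1 : regfun R d := comb phi [:: lp; ln] (pair (x + del * r ^+ 2) y).
pose h : regfun R d := comb phi [:: lp] (fun=> del * r ^+ 2).
have hE t : h t = del * r ^+ 2 * phi lp t by rewrite /h/= /comb big_seq1.
have f01 t : f1 t = f0 t + h t by rewrite hE /f0 /f1/= !pairE; ring.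
(* Here [V] is the sum of the [h (t_i) ^+ 2], with mean [del ^+ 2] and threshold [del]. Bad designs
   cost [del <= 1 / 8], and the divergence [expR del - 1 <= 1 / 4] costs its square root; 3/8
   remains. *)
have test (D : set (data R d n)) : measurable D ->
    1%:R^-1 * \sum_(s <- [:: tt]) fine (data_law n f1 D) <=
    fine (data_law n f0 D) + (1 / 2 + 8^-1).
  move=> mD; pose b : R := expR del - 1.
  have b0 : 0 < b by rewrite subr_gt0 expR_gt1.
  have del8 : del <= 8^-1 by rewrite /del; lra.
  have b4 : b <= (1 / 2) ^+ 2.
    have h4 : 1 - del <= expR (- del) by have := expR_ge1Dx (- del).
    have e1 := expRxMexpNx_1 del; have e0 := expR_gt0 del.
    rewrite /b; nra.
  have sb : Num.sqrt b <= 1 / 2.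
    by have := ler_wsqrtr b4; rewrite sqrtr_sqr ger0_norm.
  have mh2 : measurable_fun [set: pt] (fun t => h t ^+ 2) by exact: measurable_funX.
  have := @avg_test_power_le R d unit n f0 [:: tt] (fun=> h) (fun=> f1)
    (fun t => \sum_(i < n) h (tnth t i) ^+ 2) del (del ^+ 2) b isT (fun=> f01).
  move=> /(_ _ _ del0 b0 _ _ D mD) H.
  apply: (le_trans (H _ _ _ _)) => //.
  - apply: measurable_sum => i.
    by apply: (measurableT_comp mh2); exact: measurable_tnth.
  - by move=> t; apply: sumr_ge0 => i _; exact: sqr_ge0.
  - rewrite (iid_integral_sum U n mh2); last by move=> t; exact: sqr_ge0.
    have -> : (\int[U]_t (h t ^+ 2)%:E = ((del * r ^+ 2) ^+ 2)%:E)%E.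
      by rewrite (integral_comb_sqr hphi) ?big_seq1.
    rewrite -EFinM lee_fin exprMn -exprM mulrCA.
    by rewrite (_ : (2 * 2)%N = 4%N)// r4 mulr1.
  - move=> t Vt; rewrite !big_seq1 expr1n mulr1 /b addrC subrK ler_expR.
    by under eq_bigr do rewrite -expr2.
  - rewrite -addrA lerD2l lerD// expr2 mulfK ?gt_eqF//.
apply: (le_trans _ (@minimax_risk_ge R d unit n (F0 phi c q L T)
  (F1 phi c q L T (Num.sqrt (2 * q lp * x * del) * r)) f0 [:: tt] (fun=> f1)
  (fun=> 0) (1 / 2 + 8^-1) 0 _ _ _ _ _ test)) => //.
- lra.
- split; last by rewrite /f0 Q_pair.
  apply: (@pair_Sigma T B) => //; first exact: ltW.
    by rewrite gtr0_norm//; rewrite /del in xdel; lra.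
  by rewrite gtr0_norm//; rewrite /del in ydel; lra.
- move=> _ _; left; split.
    apply: (@pair_Sigma T B) => //; first exact: ltW.
      have : del * r ^+ 2 <= del by rewrite ler_piMr// ltW.
      rewrite gtr0_norm ?(addr_gt0 x0 (mulr_gt0 del0 r20))//.
      by rewrite /del in xdel *; lra.
    by rewrite gtr0_norm//; rewrite /del in ydel; lra.
  rewrite /f1 Q_pair exprMn sqr_sqrtr; last exact: ltW.
  rewrite (_ : _ + _ = 2 * q lp * x * del * r ^+ 2 + q lp * (del * r ^+ 2) ^+ 2).
    rewrite ger0_norm; last first.
      apply: addr_ge0; first by apply: mulr_ge0; [exact: ltW|exact: sqr_ge0].
      by apply: mulr_ge0; [exact: ltW|exact: sqr_ge0].
    by rewrite lerDl; apply: mulr_ge0; [exact: ltW|exact: sqr_ge0].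
  rewrite -[RHS]addr0 -Q0; ring.
- by rewrite big_seq1 mulr0.
Qed.

End two_point.

(** * Choice of the amplitude *)

Section parameters.
Context {R : realType} {I : countType} (c q : I -> R).

Lemma NT_mono T T' : T <= T' -> NT c q T `<=` NT c q T'.
Proof.
move=> TT l /= [q0 cT]; split=> //; apply: (lt_le_trans cT).
by rewrite ler_wpM2r.
Qed.

Lemma NTstar_sub T : NTstar c q T `<=` NT c q T.
Proof. by rewrite /NTstar; case: ifP => _ l []. Qed.

Lemma NTstar_sign T : (forall l, NTstar c q T l -> 0 < q l) \/
  (forall l, NTstar c q T l -> q l < 0).
Proof.
by rewrite /NTstar; case: ifP => _; [left|right] => l [].
Qed.

Lemma M_split T : finite_set (NT c q T) -> M c q T = Mpos c q T + Mneg c q T.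
Proof.
move=> fT; rewrite /M /Mpos /Mneg /sumsq -fsbigU0.
- congr (\sum_(l \in _) _); apply/seteqP; split => l; last by move=> [] [].
  move=> lT; have [q0 _] := lT.
  by have [h|h|h] := ltgtP (q l) 0; [right|left|rewrite h eqxx in q0].
- exact: finite_setIr.
- exact: finite_setIr.
- by move=> l [[h _] [h' _]]; have := lt_trans h h'; rewrite ltxx.
Qed.

Lemma le_M_NTstar T : finite_set (NT c q T) ->
  M c q T <= 2 * sumsq q (NTstar c q T).
Proof.
move=> fT; rewrite M_split// /NTstar.
by case: ltP; rewrite -/(Mpos c q T) -/(Mneg c q T); lra.
Qed.

(** The last bound passes from the squares in [D1] to the sum of |q_l| that appears in [Q]: [K * m
    ^+ 2 <= D * M <= 2 * D * sumsq q N* <= 2 * D * m * S], and one factor [m] is cancelled. *)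
Lemma NTstar_bounds T D : finite_set (NT c q T) -> 0 < D ->
  let N : R := (Defs.card (NTstar c q T))%:R in
  let K : R := (Defs.card (NT c q T))%:R in
  let m2 := \big[Num.max/0]_(l <- fset_set (NT c q T)) q l ^+ 2 in
  let m := Num.sqrt m2 in
  let S := \sum_(l <- fset_set (NTstar c q T)) `|q l| in
  (0 < Defs.card (NTstar c q T))%N -> K * m2 <= D * M c q T ->
  [/\ 0 < m, forall l, NT c q T l -> `|q l| <= m, N <= K,
    M c q T <= K * m ^+ 2 & K * m <= 2 * D * S].
Proof.
move=> fT D0 N K m2 m S card0 hD.
have fS : finite_set (NTstar c q T) by apply: sub_finite_set fT; exact: NTstar_sub.
have qm2 l : NT c q T l -> q l ^+ 2 <= m2.
  move=> lT; apply: (@le_bigmax_seq _ _ _ _ 0 l xpredT (fun l => q l ^+ 2)) => //.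
  by rewrite in_fset_set ?mem_set.
have m20 : 0 < m2.
  move: card0; rewrite /Defs.card cardfs_gt0 => /fset0Pn[l].
  rewrite in_fset_set// inE => /NTstar_sub lT.
  apply: lt_le_trans (qm2 l lT); rewrite exprn_even_gt0//.
  by case: lT.
have mm : m ^+ 2 = m2 by rewrite sqr_sqrtr// ltW.
have m0 : 0 < m by rewrite sqrtr_gt0.
have qm l : NT c q T l -> `|q l| <= m.
  by move=> lT; rewrite -sqrtr_sqr ler_wsqrtr// qm2.
have NK : N <= K.
  rewrite /N /K ler_nat; apply: fsubset_leq_card.
  by rewrite -fset_set_sub//; exact: NTstar_sub.
have MK : M c q T <= K * m ^+ 2.
  rewrite mm /M /sumsq fsbig_finite//= /K /Defs.card -sumr_const_seq.
  rewrite big_seq [leRHS]big_seq; apply: ler_sum => l.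
  by rewrite in_fset_set// inE => /qm2.
split=> //.
have SM : sumsq q (NTstar c q T) <= m * S.
  rewrite /sumsq fsbig_finite//= /S mulr_sumr big_seq [leRHS]big_seq.
  apply: ler_sum => l; rewrite in_fset_set// inE => /NTstar_sub lT.
  rewrite -(real_normK (num_real (q l))) expr2 ler_wpM2r// qm//.
rewrite -(ler_pM2l m0) [leLHS](_ : _ = K * m2); last by rewrite -mm; ring.
apply: (le_trans hD); have := le_M_NTstar fT => h.
apply: (@le_trans _ _ (D * (2 * (m * S)))).
  by rewrite ler_pM2l// (le_trans h)// ler_pM2l.
by rewrite [leRHS](_ : _ = D * (2 * (m * S)))//; ring.
Qed.

(** Here [a2] is the squared amplitude. The first bound controls the mean of the Frobenius norm and
    the L_4 norm, the second the norm of [f * TQ f]. Both rest on [K * m <= 2 * D * S], after which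
    [S] and [T] are absorbed by [a2 * (T * S) = kap]; the second also uses [1 <= T]. *)
Lemma amplitude_bounds (n N K z T m S D M kap a2 : R) :
  0 <= n -> 0 <= N -> N <= K -> 0 < z -> 1 <= T -> 0 < m -> 0 < S -> 0 < kap ->
  0 <= M -> n / z <= 4 * T * Num.sqrt M -> M <= K * m ^+ 2 -> K * m <= 2 * D * S ->
  a2 * (T * S) = kap ->
  n ^+ 2 * a2 ^+ 2 * N <= 64 * z ^+ 2 * D ^+ 2 * kap ^+ 2 /\
  a2 * N * m <= 2 * D * kap.
Proof.
move=> n0 N0 NK z0 T1 m0 S0 k0 M0 hn MK KS a2E.
have T0 : 0 < T by rewrite (lt_le_trans ltr01).
have P0 : 0 < T * S by rewrite mulr_gt0.
have a20 : 0 < a2 by rewrite -(pmulr_lgt0 _ P0) a2E.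
have K0 : 0 <= K by rewrite (le_trans N0).
have H16 : 0 <= 16 * z ^+ 2 * T ^+ 2.
  by apply: mulr_ge0; [apply: mulr_ge0 => //; exact: sqr_ge0|exact: sqr_ge0].
have n2 : n ^+ 2 <= 16 * z ^+ 2 * T ^+ 2 * M.
  move: hn; rewrite ler_pdivrMr// => hn.
  have -> : 16 * z ^+ 2 * T ^+ 2 * M = (4 * T * Num.sqrt M * z) ^+ 2.
    by rewrite !exprMn sqr_sqrtr//; ring.
  by rewrite lerXn2r// nnegrE// (le_trans n0).
have nN : n ^+ 2 * N <= 64 * z ^+ 2 * D ^+ 2 * (T * S) ^+ 2.
  apply: (@le_trans _ _ (16 * z ^+ 2 * T ^+ 2 * (K * m) ^+ 2)).
    apply: (@le_trans _ _ (16 * z ^+ 2 * T ^+ 2 * M * K)).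
      by apply: ler_pM => //; exact: sqr_ge0.
    rewrite [leRHS](_ : _ = 16 * z ^+ 2 * T ^+ 2 * (K * m ^+ 2) * K); last by ring.
    by apply: ler_wpM2r => //; exact: ler_wpM2l.
  rewrite [leRHS](_ : _ = 16 * z ^+ 2 * T ^+ 2 * (2 * D * S) ^+ 2); last by ring.
  apply: ler_wpM2l => //.
  have Km0 : 0 <= K * m by rewrite mulr_ge0// ltW.
  by rewrite lerXn2r// nnegrE// (le_trans Km0).
split.
  rewrite [leLHS](_ : _ = n ^+ 2 * N * a2 ^+ 2); last by ring.
  rewrite -a2E [leRHS](_ : _ = 64 * z ^+ 2 * D ^+ 2 * (T * S) ^+ 2 * a2 ^+ 2); last by ring.
  by rewrite ler_wpM2r ?sqr_ge0.
apply: (@le_trans _ _ (a2 * (2 * D * S))).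
  rewrite -mulrA ler_pM2l//; apply: le_trans KS.
  by apply: ler_wpM2r => //; exact: ltW.
have DS0 : 0 <= 2 * D * S by rewrite (le_trans _ KS)// mulr_ge0// ltW.
rewrite -a2E [leRHS](_ : _ = a2 * (2 * D * S) * T); last by ring.
by rewrite ler_peMr// mulr_ge0// ltW.
Qed.

End parameters.

(** * Choice of the constants and conclusion *)

Theorem theorem4 (R : realType) (d : nat) (hd : (0 < d)%N)
  (I : countType) (phi : I -> regfun R d) (c q : I -> R)
  (hphi : orthonormal_basis phi)
  (hc : forall l, 0 <= c l)
  (hfin : forall T : R, 0 < T -> finite_set (NT c q T))
  (L : R) (hL : 0 < L)
  (hpos : Lpos q !=set0) (hneg : Lneg q !=set0) :
  (* part 1 *)
  (forall T : nat -> R, (forall n, (0 < n)%N -> 0 < T n) ->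
    (* some phi_l in L_4 in each class; without this Sigma_L may reduce to {0} *)
    (exists2 l, Lpos q l & (LqNorm 4 (phi l) < +oo)%E) ->
    (exists2 l, Lneg q l & (LqNorm 4 (phi l) < +oo)%E) ->
    forall gamma : R, gamma < 4^-1 ->
    exists C : R, 0 < C /\
      (gamma%:E < limn_einf (fun n =>
        (minimax_risk n (F0 phi c q L (T n))
          (F1 phi c q L (T n) (C * n%:R `^ (- 4^-1))))%:E))%E)
  /\
  (* part 2 *)
  (forall gamma : R, 0 < gamma < 1 ->
    forall T : nat -> R, (forall n, (0 < n)%N -> 0 < T n) ->
    (\forall n \near \oo,
      n%:R * (gauss_quantile (1 - gamma / 2))^-1
        <= 4 * T n * Num.sqrt (M c q (T n))) ->
    D1 c q T -> D5 c q T -> D6 phi c q T ->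
    exists C : R, 0 < C /\
      (gamma%:E <= limn_einf (fun n =>
        (minimax_risk n (F0 phi c q L (T n))
          (F1 phi c q L (T n) (C * T n `^ (- 2^-1))))%:E))%E).
Proof.
split.
  move=> T T0 [lp qp phip] [ln qn phin] gamma g4.
  have [C [C0 HC]] := two_point_minimax_risk hphi hc hL qp qn phip phin.
  exists C; split=> //; apply: (@lt_le_trans _ _ (3 / 8 : R)%:E).
    by rewrite lte_fin; lra.
  apply: le_limn_einf; exists 1%N => // n /= n0.
  by rewrite lee_fin; exact: HC.
move=> gamma /andP[g0 g1] T T0 hT [D [D0 hD]] [hN1 hN2] [E [E0 hE]].
set z := gauss_quantile _ in hT.
have z0 : 0 < z by apply: gauss_quantile_gt0; lra.
(* The three losses are at most [del] each: the square root of the divergence through [tau], bad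
   designs through [v = del * tau], and violated norm constraints through [e = del]. *)
pose del : R := (1 - gamma) / 3.
have del0 : 0 < del by rewrite divr_gt0// subr_gt0.
have ln0 : 0 < ln (1 + del ^+ 2) by rewrite ln_gt0// ltrDl exprn_gt0.
pose tau : R := Num.min 32^-1 (ln (1 + del ^+ 2) / 4).
have tau0 : 0 < tau by rewrite lt_min invr_gt0 ltr0n divr_gt0.
have tau1 : tau <= 32^-1 by rewrite ge_min lexx.
have sb : Num.sqrt (expR (4 * tau) - 1) <= del.
  have : expR (4 * tau) - 1 <= del ^+ 2.
    have : expR (4 * tau) <= expR (ln (1 + del ^+ 2)).
      rewrite ler_expR mulrC -ler_pdivlMr//.
      by rewrite ge_min lexx orbT.
    rewrite lnK; first by lra.
    by rewrite posrE addr_gt0// exprn_gt0.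
  by move/ler_wsqrtr; rewrite sqrtr_sqr ger0_norm// ltW.
(* [kap ^+ 2 * C1 <= 1] will give the bound [v]; the same with [C2] and [C3] gives [del / 2] for the
   L_4 and the product constraint. The summand 1 in [kap] ensures [kap <= 1], used for the energy
   constraint and for [kap ^+ 2 <= kap]. *)
pose C1 : R := (E ^+ 2 + E) * (64 * z ^+ 2 * D ^+ 2) / (del * tau).
pose C2 : R := 2 * (3 * E ^+ 2 * (64 * z ^+ 2 * D ^+ 2)) / (L ^+ 4 * del).
pose C3 : R := 2 * (3 * E ^+ 2 * (2 * D) ^+ 2) / (L ^+ 2 * del).
have L4 : 0 < L ^+ 4 by rewrite exprn_gt0.
have L2 : 0 < L ^+ 2 by rewrite exprn_gt0.
have X0 : 0 < 64 * z ^+ 2 * D ^+ 2 by rewrite mulr_gt0 ?exprn_gt0// mulr_gt0 ?exprn_gt0.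
have E2 : 0 < E ^+ 2 by rewrite exprn_gt0.
have C10 : 0 < C1 by rewrite divr_gt0// mulr_gt0// addr_gt0.
have C20 : 0 < C2.
  apply: divr_gt0; last exact: mulr_gt0.
  by apply: mulr_gt0 => //; apply: mulr_gt0 => //; exact: mulr_gt0.
have C30 : 0 < C3.
  apply: divr_gt0; last exact: mulr_gt0.
  apply: mulr_gt0 => //; apply: mulr_gt0; first exact: mulr_gt0.
  by rewrite exprn_gt0// mulr_gt0.
pose kap : R := (1 + C1 + C2 + C3)^-1.
have kS : 0 < 1 + C1 + C2 + C3 by lra.
have kap0 : 0 < kap by rewrite invr_gt0.
have kapE : kap * (1 + C1 + C2 + C3) = 1 by rewrite mulVf// gt_eqF.
have kap1 : kap <= 1 by nra.
have kC x : 0 <= x -> x <= 1 + C1 + C2 + C3 -> kap ^+ 2 * x <= 1.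
  move=> x0 x1; have : kap * x <= 1 by rewrite -kapE ler_pM2l.
  by have := mulr_ge0 (ltW kap0) x0; nra.
exists (Num.sqrt kap); split; first by rewrite sqrtr_gt0.
apply: le_limn_einf.
have nbig A : \forall n \near \oo, A <= (Defs.card (NTstar c q (T n)))%:R :> R.
  by move/cvgryPge : hN1; exact.
have nlog := (iffLR (eqoP _ _ _) hN2) 1 ltr01.
near=> n.
have n0 : (0 < n)%N by near: n; exists 1%N.
have nR1 : 1 <= n%:R :> R by rewrite ler1n.
have hTn : n%:R * z^-1 <= 4 * T n * Num.sqrt (M c q (T n)) by near: n.
set Ncard := Defs.card (NTstar c q (T n)).
pose N : R := Ncard%:R.
(* Since e <= 4, this gives [1 <= ln N], and then [N * ln N <= n] gives [N <= n]. *)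
have N4 : 4 <= N by rewrite /N /Ncard; near: n; exact: nbig.
have NNT1 : (Defs.card (NT c q 1)).+1%:R <= N by rewrite /N /Ncard; near: n; exact: nbig.
have Nlog : `|N * ln N| <= 1 * `|n%:R : R| by rewrite /N /Ncard; near: n; exact: nlog.
have N0 : 0 < N by rewrite (lt_le_trans _ N4).
have lnN : 1 <= ln N.
  have e2 : expR (1 / 2) <= 2 :> R.
    have h := expR_ge1Dx (- (1 / 2) : R).
    have e1 := expRxMexpNx_1 (1 / 2 : R); have e0 := expR_gt0 (1 / 2 : R).
    nra.
  rewrite -[leLHS]expRK ler_ln ?posrE ?expR_gt0//.
  have -> : 1 = 1 / 2 + 1 / 2 :> R by field.
  rewrite expRD; have := expR_gt0 (1 / 2 : R); nra.
have Nn : N <= n%:R.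
  have lN0 : 0 <= ln N by rewrite (le_trans ler01).
  have NlN0 : 0 <= N * ln N by rewrite mulr_ge0// ltW.
  move: Nlog; rewrite mul1r (ger0_norm NlN0) normr_nat; apply: le_trans.
  by apply: ler_peMr => //; exact: ltW.
have Tn0 := T0 n n0; have fin := hfin _ Tn0.
have fS : finite_set (NTstar c q (T n)).
  by apply: sub_finite_set fin; exact: NTstar_sub.
(* For [T n < 1] the set [NTstar] would lie in the fixed finite set [NT c q 1], whose cardinal [N]
   exceeds by [NNT1]. *)
have T1 : 1 <= T n.
  rewrite leNgt; apply/negP => T1; move: NNT1; rewrite ler_nat leqNgt ltnS.
  move/negP; apply; apply: fsubset_leq_card; rewrite -fset_set_sub//.
    by move=> l /NTstar_sub; exact: NT_mono (ltW T1) l.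
  exact: hfin.
have card0 : (0 < Ncard)%N by rewrite -(ltr_nat R).
have [m0 qm NK MK KS] := NTstar_bounds fin D0 card0 (hD n n0).
set J := fset_set (NTstar c q (T n)) in KS.
set m := Num.sqrt _ in m0 qm MK KS.
set S := \sum_(l <- J) _ in KS.
set K := (Defs.card (NT c q (T n)))%:R in NK MK KS.
have S0 : 0 < S.
  have Km : 0 < K * m by rewrite mulr_gt0// (lt_le_trans N0).
  have := lt_le_trans Km KS; rewrite pmulr_rgt0//.
  by rewrite mulr_gt0.
have P0 : 0 < T n * S by rewrite mulr_gt0.
(* With this amplitude the separation [rho ^+ 2 = kap / T n] is attained with equality. *)
pose a : R := Num.sqrt (kap / (T n * S)).
have a0 : 0 < a by rewrite sqrtr_gt0 divr_gt0.
have a2E : a ^+ 2 * (T n * S) = kap.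
  by rewrite sqr_sqrtr ?divfK ?gt_eqF// ltW// divr_gt0.
have M0 : 0 <= M c q (T n) by apply: fsumr_ge0 => l _; exact: sqr_ge0.
have [b1 b2] := amplitude_bounds (ler0n R n) (ltW N0) NK z0 T1 m0 S0 kap0 M0
  hTn MK KS a2E.
have kap2 x y : 0 < y -> 0 <= x / y -> x / y <= 1 + C1 + C2 + C3 -> kap ^+ 2 * x <= y.
  by move=> y0 xy0 xy; have := kC _ xy0 xy; rewrite mulrA ler_pdivrMr// mul1r.
have NNn : N ^+ 2 <= n%:R * N by rewrite expr2 ler_pM2r.
have nn2 : n%:R <= n%:R ^+ 2 :> R by rewrite expr2 ler_peMr.
have a4 : a ^+ 4 = (a ^+ 2) ^+ 2 by ring.
have a40 : 0 <= a ^+ 4 by rewrite exprn_ge0// ltW.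
have JS l : l \in J -> NTstar c q (T n) l by rewrite in_fset_set// inE.
rewrite lee_fin; apply: le_trans (@sign_prior_minimax_risk R d I phi c q L (T n) n J a m (E * N)
  (Num.sqrt kap * T n `^ (- 2^-1)) (del * tau) del tau hphi hc hL _ _ _ _ m0 _ a0 _
  _ tau0 tau1 _ _ _ _).
- rewrite mulfK ?gt_eqF//; move: sb; rewrite /del; lra.
- exact: fset_uniq.
- exact: card0.
- by move=> l /JS/NTstar_sub.
- by have [h|h] := NTstar_sign c q (T n); [left|right] => l /JS/h.
- by move=> l /JS/NTstar_sub/qm.
- by rewrite mulr_ge0// ltW.
- by move=> t ct; have := hE n n0 t ct; rewrite fsbig_finite.
- rewrite -mulr_suml (le_trans _ kap1)// -a2E mulrC ler_pM2l ?exprn_gt0//.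
  rewrite /S mulr_sumr big_seq [leRHS]big_seq; apply: ler_sum => l /JS/NTstar_sub[_].
  exact: ltW.
- rewrite exprMn sqr_sqrtr; last exact: ltW.
  have -> : T n `^ (- 2^-1) ^+ 2 = (T n)^-1.
    by rewrite -powR_mulrn ?powR_ge0// -powRrM mulNr mulVf// powRN powRr1// ltW.
  rewrite -a2E -/S (_ : _ / _ = a ^+ 2 * S)//.
  by field; rewrite gt_eqF.
- have b1' : a ^+ 4 * (n%:R ^+ 2 * N) <= 64 * z ^+ 2 * D ^+ 2 * kap ^+ 2.
    by apply: le_trans b1; rewrite a4 [leLHS](_ : _ = n%:R ^+ 2 * a ^+ 2 ^+ 2 * N)//; ring.
  apply: (@le_trans _ _ (kap ^+ 2 * ((E ^+ 2 + E) * (64 * z ^+ 2 * D ^+ 2)))).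
    apply: (@le_trans _ _ ((E ^+ 2 + E) * (a ^+ 4 * (n%:R ^+ 2 * N)))).
      have : n%:R * N ^+ 2 <= n%:R ^+ 2 * N :> R.
        by rewrite [leRHS](_ : _ = n%:R * (n%:R * N)) ?ler_wpM2l//; ring.
      move=> h; rewrite -subr_ge0 [leRHS](_ : _ = a ^+ 4 * E ^+ 2 *
        (n%:R ^+ 2 * N - n%:R * N ^+ 2)); last by ring.
      by rewrite mulr_ge0 ?subr_ge0// mulr_ge0// ltW.
    rewrite [leRHS](_ : _ = (E ^+ 2 + E) * (64 * z ^+ 2 * D ^+ 2 * kap ^+ 2)); last by ring.
    by apply: ler_wpM2l b1'; rewrite ltW// addr_gt0.
  apply: kap2; first exact: mulr_gt0.
    exact: ltW.
  by rewrite -/C1; lra.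
- have b1' : a ^+ 4 * N ^+ 2 <= kap ^+ 2 * (64 * z ^+ 2 * D ^+ 2).
    rewrite [leRHS]mulrC; apply: le_trans b1.
    rewrite [leRHS](_ : _ = a ^+ 4 * (n%:R ^+ 2 * N)); last by rewrite a4; ring.
    apply: ler_wpM2l => //; apply: (le_trans NNn).
    by rewrite ler_pM2r.
  have b2' : a ^+ 4 * m ^+ 2 * N ^+ 2 <= kap ^+ 2 * (2 * D) ^+ 2.
    rewrite [leLHS](_ : _ = (a ^+ 2 * N * m) ^+ 2); last by rewrite a4; ring.
    rewrite [leRHS](_ : _ = (2 * D * kap) ^+ 2); last by ring.
    rewrite lerXn2r// nnegrE; first by rewrite !mulr_ge0 ?sqr_ge0// ltW.
    by rewrite !mulr_ge0// ltW.
  have h4 : 3 * a ^+ 4 * (E * N) ^+ 2 / L ^+ 4 <= del / 2.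
    rewrite ler_pdivrMr//.
    apply: (@le_trans _ _ (kap ^+ 2 * (3 * E ^+ 2 * (64 * z ^+ 2 * D ^+ 2)))).
      rewrite [leLHS](_ : _ = 3 * E ^+ 2 * (a ^+ 4 * N ^+ 2)); last by ring.
      rewrite [leRHS](_ : _ = 3 * E ^+ 2 * (kap ^+ 2 * (64 * z ^+ 2 * D ^+ 2))); last by ring.
      by apply: ler_wpM2l b1'; rewrite mulr_ge0 ?sqr_ge0.
    have e : 3 * E ^+ 2 * (64 * z ^+ 2 * D ^+ 2) / (del / 2 * L ^+ 4) = C2.
      by rewrite /C2; field; rewrite !gt_eqF.
    apply: kap2; rewrite ?e; [|exact: ltW|lra].
    by rewrite mulr_gt0// divr_gt0.
  have h2 : 3 * a ^+ 4 * m ^+ 2 * (E * N) ^+ 2 / L ^+ 2 <= del / 2.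
    rewrite ler_pdivrMr//.
    apply: (@le_trans _ _ (kap ^+ 2 * (3 * E ^+ 2 * (2 * D) ^+ 2))).
      rewrite [leLHS](_ : _ = 3 * E ^+ 2 * (a ^+ 4 * m ^+ 2 * N ^+ 2)); last by ring.
      rewrite [leRHS](_ : _ = 3 * E ^+ 2 * (kap ^+ 2 * (2 * D) ^+ 2)); last by ring.
      by apply: ler_wpM2l b2'; rewrite mulr_ge0 ?sqr_ge0.
    have e : 3 * E ^+ 2 * (2 * D) ^+ 2 / (del / 2 * L ^+ 2) = C3.
      by rewrite /C3; field; rewrite !gt_eqF.
    apply: kap2; rewrite ?e; [|exact: ltW|lra].
    by rewrite mulr_gt0// divr_gt0.
  by lra.
Unshelve. all: by end_near.
Qed.
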